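(* Let $\Lambda$ be a Gorenstein artin algebra and let $\mathcal{C}$ be an $n\mathbb{Z}$-cluster tilting subcategory of $\mathrm{mod}\text{-}\Lambda$. Then $\mathcal{C}$ is an $n\mathbb{Z}$-G-cluster tilting subcategory of $\mathrm{mod}\text{-}\Lambda$. Moreover, in this case $n\mathbb{Z}\text{-}\mathrm{Gprj}\text{-}\mathcal{C}=\mathrm{Gprj}\text{-}\Lambda\cap\mathcal{C}$ and $n\mathbb{Z}\text{-}\mathrm{Ginj}\text{-}\mathcal{C}=\mathrm{Ginj}\text{-}\Lambda\cap\mathcal{C}$.
   Context: $n$ is a positive integer, $\Lambda$ is an artin algebra over a commutative artinian ring, $\mathrm{mod}\text{-}\Lambda$ is the category of finitely generated right $\Lambda$-modules. $\Lambda$ is (Iwanaga-)Gorenstein if it has finite injective dimension both as a right and as a left module over itself. $\Omega^k$ and $\Omega^{-k}$ denote $k$-th syzygies and cosyzygies. $\mathrm{Gprj}\text{-}\Lambda$ and $\mathrm{Ginj}\text{-}\Lambda$ are the full subcategories of $\mathrm{mod}\text{-}\Lambda$ of Gorenstein projective and Gorenstein injective modules. A full subcategory $\mathcal{C}$ of $\mathrm{mod}\text{-}\Lambda$ is $n$-cluster tilting if it is functorially finite and $\mathcal{C}=\{X\mid \mathrm{Ext}^i_\Lambda(\mathcal{C},X)=0 \text{ for all } 0<i<n\}=\{X\mid \mathrm{Ext}^i_\Lambda(X,\mathcal{C})=0\text{ for all } 0<i<n\}$. It is $n\mathbb{Z}$-cluster tilting if moreover $\mathrm{Ext}^i_\Lambda(\mathcal{C},\mathcal{C})=0$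 for all $i>0$ with $i\notin n\mathbb{Z}$ (equivalently $\Omega^n(\mathcal{C})\subseteq\mathcal{C}$; equivalently $\Omega^{-n}(\mathcal{C})\subseteq\mathcal{C}$). An acyclic complex $\mathbf{P}:\cdots\to P^{-1}\to P^0\to P^1\to\cdots$ of finitely generated projective $\Lambda$-modules, with $Z^j=\mathrm{Ker}(P^j\to P^{j+1})$, is called $n\mathbb{Z}$-totally acyclic if (i) for every $i\in\mathbb{Z}$ and every projective $\Lambda$-module $Q$, applying $\mathrm{Hom}_\Lambda(-,Q)$ to the exact sequence $0\to Z^{in}\to P^{in}\to\cdots\to P^{(i+1)n-1}\to Z^{(i+1)n}\to 0$ gives an acyclic complex, and (ii) $Z^{in}\in\mathcal{C}$ for all $i\in\mathbb{Z}$. A module $G\in\mathcal{C}$ is $n\mathbb{Z}$-Gorenstein projective if $G\cong Z^{in}$ for some $i$ and some $n\mathbb{Z}$-totally acyclic complex; $n\mathbb{Z}\text{-}\mathrm{Gprj}\text{-}\mathcal{C}$ is the full subcategory of these modules. Dually (using acyclic complexes of finitely generated injectives and the functors $\mathrm{Hom}_\Lambda(I,-)$ with $I$ injective) one defines $n\mathbb{Z}$-Gorenstein injective modules in $\mathcal{C}$ and the full subcategory $n\mathbb{Z}\text{-}\mathrm{Ginj}\text{-}\mathcal{C}$. An $n\mathbb{Z}$-cluster tilting subcategory $\mathcal{C}$ is $n\mathbb{Z}$-G-cluster tilting if for every $C\in\mathcal{C}$ there is an integer $i\ge 0$ with $\Omega^{in}(C)\in n\mathbb{Z}\text{-}\mathrm{Gprj}\text{-}\mathcal{C}$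 and there is an integer $i\ge0$ with $\Omega^{-in}(C)\in n\mathbb{Z}\text{-}\mathrm{Ginj}\text{-}\mathcal{C}$. *)

(* Defs.v *)
From HB Require Import structures.
From mathcomp Require Import all_boot all_order all_algebra.

Set Implicit Arguments.
Unset Strict Implicit.
Unset Printing Implicit Defensive.

Import GRing.Theory.
Local Open Scope ring_scope.

(* Modules are left modules over an arbitrary ring R; right modules over L are
   obtained by taking R := L^c, the converse ring. *)

Definition artinian_ring (k : comPzRingType) : Prop :=
  forall I : nat -> {pred k^o},
    (forall i, GRing.submod_closed (I i)) ->
    (forall i, {subset I i.+1 <= I i}) ->
  exists N : nat, forall i : nat, (N <= i)%N -> I i =i I N.

Definition fin_gen (R : pzRingType) (M : lmodType R) : Prop :=
  exists (m : nat) (e : 'I_m -> M),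
  forall x, exists c : 'I_m -> R, x = \sum_(i < m) c i *: e i.

Definition artin_algebra (k : comPzRingType) (L : algType k) : Prop :=
  artinian_ring k /\ fin_gen (L : lmodType k).

Definition isomorphic (R : pzRingType) (A B : lmodType R) : Prop :=
  exists f : {linear A -> B}, bijective f.

Definition surjective (A B : Type) (f : A -> B) : Prop :=
  forall y, exists x, y = f x.

Section Kernel.
Variables (R : pzRingType) (A B : lmodType R) (f : {linear A -> B}).

Definition ker_pred : {pred A} := [pred x | f x == 0].

Fact ker_pred_closed : GRing.submod_closed ker_pred.
Proof.
split=> [|a x y]; rewrite !inE ?linear0 // linearP.
by move=> /eqP -> /eqP ->; rewrite scaler0 addr0.
Qed.

HB.instance Definition _ :=
  GRing.isSubmodClosed.Build R A ker_pred ker_pred_closed.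

Definition Ker : Type := {x : A | x \in ker_pred}.
HB.instance Definition _ := SubChoice.on Ker.
HB.instance Definition _ := [SubChoice_isSubLmodule of Ker by <:].

Definition ker_incl : {linear Ker -> A} := \val.

End Kernel.

Section Corestriction.
Variables (R : pzRingType) (A B C : lmodType R).
Variables (f : {linear A -> B}) (g : {linear B -> C}).
Hypothesis gf0 : forall x, g (f x) = 0.

Fact ker_lift_subproof x : f x \in ker_pred g.
Proof. by rewrite inE gf0. Qed.

Definition ker_lift_fun (x : A) : Ker g := Sub (f x) (ker_lift_subproof x).

Fact ker_lift_linear : linear ker_lift_fun.
Proof. by move=> a x y; apply: val_inj; rewrite /= !linearP. Qed.

HB.instance Definition _ :=
  GRing.isLinear.Build R A (Ker g) _ ker_lift_fun ker_lift_linear.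

Definition ker_lift : {linear A -> Ker g} := ker_lift_fun.

End Corestriction.

Section Modules.
Variable R : pzRingType.
Implicit Types A B C M Q X Y K : lmodType R.

Definition exact_at A B C (f : {linear A -> B}) (g : {linear B -> C}) : Prop :=
  forall y, g y = 0 <-> exists x, y = f x.

Definition short_exact A B C (f : {linear A -> B}) (g : {linear B -> C}) :=
  [/\ injective f, exact_at f g & surjective g].

(* Hom(-, Q) turns A -> B -> C into a sequence exact at Hom(B, Q). *)
Definition exact_hom_to Q A B C (f : {linear A -> B}) (g : {linear B -> C}) :=
  forall phi : {linear B -> Q},
    (forall x, phi (f x) = 0) <->
    exists psi : {linear C -> Q}, forall y, phi y = psi (g y).

(* Hom(Q, -) turns A -> B -> C into a sequence exact at Hom(Q, B). *)
Definition exact_hom_from Q A B C (f : {linear A -> B}) (g : {linear B -> C}) :=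
  forall phi : {linear Q -> B},
    (forall x, g (phi x) = 0) <->
    exists psi : {linear Q -> A}, forall x, phi x = f (psi x).

Definition projective Q : Prop :=
  forall A B (p : {linear A -> B}) (g : {linear Q -> B}), surjective p ->
  exists h : {linear Q -> A}, forall x, g x = p (h x).

Definition injective_mod Q : Prop :=
  forall A B (i : {linear A -> B}) (g : {linear A -> Q}), injective i ->
  exists h : {linear B -> Q}, forall x, g x = h (i x).

Definition fg_projective Q : Prop := fin_gen Q /\ projective Q.
Definition fg_injective Q : Prop := fin_gen Q /\ injective_mod Q.

Fixpoint injdim_le (d : nat) M : Prop :=
  if d is d'.+1 then
    exists (I C : lmodType R) (f : {linear M -> I}) (g : {linear I -> C}),
      [/\ injective_mod I, short_exact f g & injdim_le d' C]
  else injective_mod M.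

Definition finite_injdim M : Prop := exists d : nat, injdim_le d M.

(* Syzygies and cosyzygies are taken along arbitrary, not necessarily minimal,
   resolutions, hence form a relation: [syzygy k X K] says that K is a k-th
   syzygy of X. *)
Fixpoint syzygy (k : nat) X K : Prop :=
  if k is k'.+1 then
    exists (P : lmodType R) (p : {linear P -> X}),
      [/\ fg_projective P, surjective p & syzygy k' (Ker p) K]
  else isomorphic X K.

Fixpoint cosyzygy (k : nat) X K : Prop :=
  if k is k'.+1 then
    exists (I C : lmodType R) (f : {linear X -> I}) (g : {linear I -> C}),
      [/\ fg_injective I, short_exact f g & cosyzygy k' C K]
  else isomorphic X K.

Definition proj_resolution X (P : nat -> lmodType R)
    (d : forall i, {linear P i.+1 -> P i}) (e : {linear P 0%N -> X}) : Prop :=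
  [/\ forall i, projective (P i), surjective e, exact_at (d 0%N) e
    & forall i, exact_at (d i.+1) (d i)].

(* Ext^i(X, Y) = 0: for every projective resolution P of X, the complex
   Hom(P, Y) has zero cohomology in degree i. *)
Definition Ext_vanishes (i : nat) X Y : Prop :=
  forall (P : nat -> lmodType R) (d : forall i, {linear P i.+1 -> P i})
    (e : {linear P 0%N -> X}), proj_resolution d e ->
  match i with
  | 0 => forall phi : {linear P 0%N -> Y},
      (forall x, phi (d 0%N x) = 0) -> forall x, phi x = 0
  | j.+1 => forall phi : {linear P j.+1 -> Y},
      (forall x, phi (d j.+1 x) = 0) ->
      exists psi : {linear P j -> Y}, forall x, phi x = psi (d j x)
  end.

(* Full subcategories of mod-R are predicates on modules. *)
Section Subcategory.
Variable C : lmodType R -> Prop.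

Definition contravariantly_finite : Prop :=
  forall X, fin_gen X ->
  exists2 M, C M & exists f : {linear M -> X},
    forall M', C M' -> forall g : {linear M' -> X},
    exists h : {linear M' -> M}, forall x, g x = f (h x).

Definition covariantly_finite : Prop :=
  forall X, fin_gen X ->
  exists2 M, C M & exists f : {linear X -> M},
    forall M', C M' -> forall g : {linear X -> M'},
    exists h : {linear M -> M'}, forall x, g x = h (f x).

Definition functorially_finite : Prop :=
  contravariantly_finite /\ covariantly_finite.

Definition cluster_tilting (n : nat) : Prop :=
  [/\ functorially_finite,
      forall X, C X <-> fin_gen X /\
        forall (i : nat) M, (0 < i < n)%N -> C M -> Ext_vanishes i M X
    & forall X, C X <-> fin_gen X /\
        forall (i : nat) M, (0 < i < n)%N -> C M -> Ext_vanishes i X M].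

Definition nZ_cluster_tilting (n : nat) : Prop :=
  cluster_tilting n /\
  forall (i : nat) M N, (0 < i)%N -> ~~ (n %| i)%N -> C M -> C N ->
    Ext_vanishes i M N.

End Subcategory.

Record complex := Complex {
  obj : int -> lmodType R;
  diff : forall j : int, {linear obj j -> obj (j + 1)};
  diffK : forall j x, diff (j + 1) (diff j x) = 0
}.

Definition cocycles (P : complex) (j : int) : lmodType R := Ker (diff P j).

Definition acyclic (P : complex) : Prop :=
  forall j, exact_at (diff P j) (diff P (j + 1)).

(* [chain A] is the type of finite sequences A -> ... of linear maps. *)
Inductive chain : lmodType R -> Type :=
| Stop A : chain A
| Arrow A B (f : {linear A -> B}) (s : chain B) : chain A.

(* E holds at every inner object of the chain. *)
Fixpoint chain_all
    (E : forall A B C, {linear A -> B} -> {linear B -> C} -> Prop)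
    A (s : chain A) : Prop :=
  match s with
  | Stop _ => True
  | Arrow A0 B0 f s' =>
      match s' in chain B return {linear A0 -> B} -> Prop with
      | Stop _ => fun _ => True
      | Arrow B1 C1 g _ => fun f => @E A0 B1 C1 f g
      end f /\ chain_all E s'
  end.

Definition zero_mod : lmodType R := 'rV[R]_0.

(* P^j -> ... -> P^(j+m) -> Z^(j+m+1) -> 0 *)
Fixpoint segment_tail (P : complex) (m : nat) (j : int) : chain (obj P j) :=
  if m is m'.+1 then Arrow (diff P j) (segment_tail P m' (j + 1))
  else Arrow (ker_lift (@diffK P j))
         (Arrow (\0 : {linear cocycles P (j + 1) -> zero_mod})
            (Stop zero_mod)).

(* 0 -> Z^j -> P^j -> ... -> P^(j+n-1) -> Z^(j+n) -> 0, for n > 0 *)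
Definition segment (P : complex) (n : nat) (j : int) : chain zero_mod :=
  Arrow (\0 : {linear zero_mod -> cocycles P j})
    (Arrow (ker_incl (diff P j)) (segment_tail P n.-1 j)).

Definition totally_acyclic_proj (P : complex) : Prop :=
  [/\ forall j, fg_projective (obj P j), acyclic P
    & forall Q, fg_projective Q ->
      forall j, exact_hom_to Q (diff P j) (diff P (j + 1))].

Definition totally_acyclic_inj (P : complex) : Prop :=
  [/\ forall j, fg_injective (obj P j), acyclic P
    & forall I : lmodType R, fg_injective I ->
      forall j, exact_hom_from I (diff P j) (diff P (j + 1))].

Definition Gprj (G : lmodType R) : Prop :=
  exists P : complex, totally_acyclic_proj P /\
  exists j : int, isomorphic G (cocycles P j).

Definition Ginj (G : lmodType R) : Prop :=
  exists P : complex, totally_acyclic_inj P /\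
  exists j : int, isomorphic G (cocycles P j).

Section NZ.
Variables (n : nat) (C : lmodType R -> Prop).

Definition nZ_totally_acyclic_proj (P : complex) : Prop :=
  [/\ forall j, fg_projective (obj P j), acyclic P,
      forall (i : int) Q, fg_projective Q ->
        chain_all (@exact_hom_to Q) (segment P n (i * n%:Z))
    & forall i : int, C (cocycles P (i * n%:Z))].

Definition nZ_totally_acyclic_inj (P : complex) : Prop :=
  [/\ forall j, fg_injective (obj P j), acyclic P,
      forall (i : int) (I : lmodType R), fg_injective I ->
        chain_all (@exact_hom_from I) (segment P n (i * n%:Z))
    & forall i : int, C (cocycles P (i * n%:Z))].

Definition nZ_Gprj (G : lmodType R) : Prop :=
  C G /\ exists P : complex, nZ_totally_acyclic_proj P /\
  exists i : int, isomorphic G (cocycles P (i * n%:Z)).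

Definition nZ_Ginj (G : lmodType R) : Prop :=
  C G /\ exists P : complex, nZ_totally_acyclic_inj P /\
  exists i : int, isomorphic G (cocycles P (i * n%:Z)).

(* Since (co)syzygies are not unique, "Omega^(in) X is in D" is read as: one
   exists, and all of them are in D. *)
Definition nZ_G_cluster_tilting : Prop :=
  [/\ nZ_cluster_tilting C n,
      forall X, C X -> exists i : nat,
        (exists K, syzygy (i * n) X K) /\
        (forall K, syzygy (i * n) X K -> nZ_Gprj K)
    & forall X, C X -> exists i : nat,
        (exists K, cosyzygy (i * n) X K) /\
        (forall K, cosyzygy (i * n) X K -> nZ_Ginj K)].

End NZ.

End Modules.

(* L^c^o is L as a right module over itself, L^o is L as a left module. *)
Definition gorenstein (L : pzRingType) : Prop :=
  finite_injdim ((L^c)^o : lmodType L^c) /\ finite_injdim (L^o : lmodType L).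

(* Main.v *)
(* Write R for the ring whose modules are considered.

   A Gorenstein projective X in C has a complete resolution with cocycles Z^j and
   Z^0 = X. Going left, Z^(-n) is an n-th syzygy, hence in C. Going right, for M in C,
   Ext^i(Z^n, M) = Ext^(i+n)(Z^n, Omega^n M) = Ext^i(X, Omega^n M) = 0 for 0 < i < n,
   because Ext(Z^n, -) kills projectives; hence Z^n is in C. Dually for injectives.
   This identifies nZ-Gprj-C and nZ-Ginj-C, and it remains to show that far enough
   syzygies (cosyzygies) are Gorenstein projective (injective).

   If R has injective dimension d, a d-th syzygy X satisfies Ext^i(X, R) = 0 for i > 0.
   Dualizing a free resolution of X gives an exact sequence of left modules, and the
   finite injective dimension on the left makes X torsionless; a left approximation by
   projectives is then injective and its cokernel has the same vanishing property, so
   that X has a complete resolution.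

   It follows that injectives have projective dimension at most d: for J injective,
   Ext^1(G, Omega^d J) = 0 for every Gorenstein projective G. So a d-th cosyzygy Y
   satisfies Ext^i(J, Y) = 0 for i > 0 and J injective. A projective cover P -> Y then
   extends to the first term of an injective coresolution of P, hence a right
   approximation of Y by injectives is surjective, and its kernel has the same
   vanishing property.

   Finitely generated injective hulls exist because an essential extension E of M has
   bounded length over k: filtering R by left ideals with simple quotients filters E
   by annihilators, with quotients embedding in M. *)
Require Import Defs.
From HB Require Import structures.
From mathcomp Require Import all_boot all_order all_algebra.
From mathcomp Require Import boolp classical_sets.

Set Implicit Arguments.
Unset Strict Implicit.
Unset Printing Implicit Defensive.

Import GRing.Theory.
Local Open Scope ring_scope.

(** * Linear maps, submodules and quotients *)

Section LinearMaps.
Variable R : pzRingType.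
Implicit Types A B C M X Y : lmodType R.

Definition mk_linear A B (f : A -> B) (lin_f : linear f) : {linear A -> B} :=
  HB.pack f (GRing.isLinear.Build R A B *:%R f lin_f).

(** Most linear maps below are built from their graph. Subtracting two values at one point gives a
    value at 0, so a total linear relation relating 0 only to 0 is single-valued, and choice makes
    it a function. *)
Lemma linear_of_rel A B (rho : A -> B -> Prop) :
    (forall x, exists y, rho x y) ->
    (forall a x y x' y', rho x y -> rho x' y' ->
       rho (a *: x + x') (a *: y + y')) ->
    (forall y, rho 0 y -> y = 0) ->
  exists f : {linear A -> B}, forall x, rho x (f x).
Proof.
move=> tot lin rho0; have uniq_rho x y y' : rho x y -> rho x y' -> y = y'.
  move=> xy xy'; apply/eqP; rewrite -subr_eq0; apply/eqP/rho0.
  by have := lin (-1) _ _ _ _ xy' xy; rewrite !scaleN1r addNr addrC.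
have [f fP] := boolp.choice tot.
have lin_f : linear f by move=> a x y; apply: (uniq_rho _ _ _ (fP _)); apply: lin.
by exists (mk_linear lin_f).
Qed.

Definition is_submod A (S : A -> Prop) : Prop :=
  S 0 /\ forall a x y, S x -> S y -> S (a *: x + y).

Lemma submodD A (S : A -> Prop) x y : is_submod S -> S x -> S y -> S (x + y).
Proof. by move=> [_ SL] Sx Sy; rewrite -[x]scale1r; apply: SL. Qed.

Lemma submodZ A (S : A -> Prop) a x : is_submod S -> S x -> S (a *: x).
Proof. by move=> [S0 SL] Sx; rewrite -[_ *: _]addr0; apply: SL. Qed.

Lemma submodN A (S : A -> Prop) x : is_submod S -> S x -> S (- x).
Proof. by move=> sS Sx; rewrite -scaleN1r; apply: submodZ. Qed.

Lemma submodB A (S : A -> Prop) x y : is_submod S -> S x -> S y -> S (x - y).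
Proof. by move=> sS Sx Sy; apply: submodD => //; apply: submodN. Qed.

(** * Quotient modules, carried by canonical representatives *)

Section Quotient.
Variables (A : lmodType R) (S : A -> Prop) (subS : is_submod S).

(** [choose] depends only on the predicate it is given, here the coset of [x]; congruent elements
    therefore get the same representative. *)
Let canon (x : A) : A := choose (fun y => `[< S (x - y) >]) x.

Let canonP x : S (x - canon x).
Proof.
apply/asboolP; apply: (@chooseP A (fun y => `[< S (x - y) >])).
by apply/asboolP; rewrite subrr; case: subS.
Qed.

Let canon_eq x y : S (x - y) -> canon x = canon y.
Proof.
move=> Sxy; have e : (fun z => `[< S (x - z) >]) =1 (fun z => `[< S (y - z) >]).
  move=> z; apply: asbool_equiv_eq; split=> Sz.
    by have := submodB subS Sz Sxy; rewrite opprB addrC addrA addrNK.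
  by have := submodD subS Sz Sxy; rewrite addrC addrA addrNK.
rewrite /canon (eq_choose e); apply: choose_id; apply/asboolP.
  by rewrite -opprB; apply: submodN.
by rewrite subrr; case: subS.
Qed.

Let canonK x : canon (canon x) = canon x.
Proof. by symmetry; apply: canon_eq. Qed.

Definition quot_mod : Type := {x : A | canon x == x}.
HB.instance Definition _ := Choice.on quot_mod.

Definition quot_pi (x : A) : quot_mod :=
  exist _ (canon x) (introT eqP (canonK x)).

Let piE x y : S (x - y) -> quot_pi x = quot_pi y.
Proof. by move=> Sxy; apply: val_inj; apply: canon_eq. Qed.

Let quot_addE x y : quot_pi (canon x + canon y) = quot_pi (x + y).
Proof.
symmetry; apply: piE; rewrite opprD addrACA.
exact: submodD (canonP _) (canonP _).
Qed.

Let quot_add (u v : quot_mod) : quot_mod := quot_pi (sval u + sval v).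
Let quot_opp (u : quot_mod) : quot_mod := quot_pi (- sval u).
Let quot_scale (a : R) (u : quot_mod) : quot_mod := quot_pi (a *: sval u).

Let quot_piK u : quot_pi (sval u) = u.
Proof. by apply: val_inj; case: u => x /= /eqP. Qed.

Let addE x y : quot_add (quot_pi x) (quot_pi y) = quot_pi (x + y).
Proof. exact: quot_addE. Qed.

Let oppE x : quot_opp (quot_pi x) = quot_pi (- x).
Proof.
by symmetry; apply: piE; rewrite -opprD; apply: submodN => //; apply: canonP.
Qed.

Let scaleE a x : quot_scale a (quot_pi x) = quot_pi (a *: x).
Proof.
by symmetry; apply: piE; rewrite -scalerBr; apply: submodZ => //; apply: canonP.
Qed.

Let addqA : associative quot_add.
Proof. by move=> u v w;
  rewrite -[u]quot_piK -[v]quot_piK -[w]quot_piK !addE addrA. Qed.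
Let addqC : commutative quot_add.
Proof. by move=> u v; rewrite -[u]quot_piK -[v]quot_piK !addE addrC. Qed.
Let add0q : left_id (quot_pi 0) quot_add.
Proof. by move=> u; rewrite -[u]quot_piK addE add0r. Qed.
Let addNq : left_inverse (quot_pi 0) quot_opp quot_add.
Proof. by move=> u; rewrite -[u]quot_piK oppE addE addNr. Qed.
HB.instance Definition _ :=
  GRing.isZmodule.Build quot_mod addqA addqC add0q addNq.

Let scaleqA a b u : quot_scale a (quot_scale b u) = quot_scale (a * b) u.
Proof. by rewrite -[u]quot_piK !scaleE scalerA. Qed.
Let scale1q : left_id 1 quot_scale.
Proof. by move=> u; rewrite -[u]quot_piK scaleE scale1r. Qed.
Let scaleqDr : right_distributive quot_scale +%R.
Proof.
move=> a u v; rewrite -[u]quot_piK -[v]quot_piK [_ + _ in LHS]addE !scaleE.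
by rewrite [RHS]addE scalerDr.
Qed.
Let scaleqDl u : {morph quot_scale^~ u : a b / a + b}.
Proof. by move=> a b; rewrite -[u]quot_piK !scaleE [RHS]addE scalerDl. Qed.
HB.instance Definition _ :=
  GRing.Zmodule_isLmodule.Build R quot_mod scaleqA scale1q scaleqDr scaleqDl.

Lemma quotient_exists :
  exists (Q : lmodType R) (p : {linear A -> Q}),
    surjective p /\ forall x, p x = 0 <-> S x.
Proof.
have lin_pi : linear quot_pi by move=> a x y; rewrite -[LHS]addE -scaleE.
exists quot_mod, (mk_linear lin_pi); split; first by move=> u; exists (sval u);
  apply: esym (quot_piK u).
move=> x; split=> [/(congr1 sval) /= e|Sx]; last by apply: piE; rewrite subr0.
(* Equal representatives of [x] and 0 give x = (x - canon x) + canon 0, a sum of two elements of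
   [S]. *)
have := submodD subS (canonP x) (submodN subS (canonP 0)).
rewrite e sub0r opprK addrNK //.
Qed.

End Quotient.

Lemma submodule_exists A (S : A -> Prop) : is_submod S ->
  exists (K : lmodType R) (i : {linear K -> A}),
    injective i /\ forall x, S x <-> exists y, x = i y.
Proof.
move=> /quotient_exists [Q [p [_ pS]]]; exists (Ker p), (ker_incl p).
split; first exact: val_inj.
move=> x; rewrite -pS; split=> [px0|[y ->]]; last by case: y => y /= /eqP.
have Kx : x \in ker_pred p by rewrite inE px0.
by exists (Sub x Kx).
Qed.

Lemma ker_exact A B (p : {linear A -> B}) : exact_at (ker_incl p) p.
Proof.
move=> x; split=> [px0|[y ->]]; last by case: y => y /= /eqP.
have Kx : x \in ker_pred p by rewrite inE px0.
by exists (Sub x Kx).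
Qed.

Lemma ker_incl_inj A B (p : {linear A -> B}) : injective (ker_incl p).
Proof. exact: val_inj. Qed.

Lemma ker_short_exact A B (p : {linear A -> B}) :
  surjective p -> short_exact (ker_incl p) p.
Proof. by split=> //; [apply: ker_incl_inj | apply: ker_exact]. Qed.

Lemma linear_inj A B (f : {linear A -> B}) :
  (forall x, f x = 0 -> x = 0) -> injective f.
Proof.
move=> f0 x y fxy; apply/eqP; rewrite -subr_eq0; apply/eqP/f0.
by rewrite linearB fxy subrr.
Qed.

Lemma im_submod A B (f : {linear A -> B}) : is_submod (fun y => exists x, y = f x).
Proof.
split=> [|a _ _ [x ->] [y ->]]; first by exists 0; rewrite linear0.
by exists (a *: x + y); rewrite linearP.
Qed.

Lemma cokernel_exists A B (f : {linear A -> B}) : injective f ->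
  exists (C : lmodType R) (g : {linear B -> C}), short_exact f g.
Proof.
by move=> inj_f; have [C [g [sg gP]]] := quotient_exists (im_submod f); exists C, g.
Qed.

Lemma factor_surj A B Y (g : {linear A -> B}) (phi : {linear A -> Y}) :
    surjective g -> (forall x, g x = 0 -> phi x = 0) ->
  exists psi : {linear B -> Y}, forall x, phi x = psi (g x).
Proof.
move=> sg g0.
have [||y [x [gx phx]]|psi psiP] :=
    @linear_of_rel B Y (fun y z => exists x, g x = y /\ phi x = z).
- by move=> y; have [x ->] := sg y; exists (phi x), x.
- move=> a y z y' z' [x [<- <-]] [x' [<- <-]].
  by exists (a *: x + x'); rewrite !linearP.
- by rewrite -phx g0.
exists psi => x; have [x' [gx' <-]] := psiP (g x).
by apply/eqP; rewrite -subr_eq0 -linearB g0 // linearB gx' subrr.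
Qed.

Lemma factor_inj A B X (f : {linear A -> B}) (phi : {linear X -> B}) :
    injective f -> (forall x, exists y, phi x = f y) ->
  exists psi : {linear X -> A}, forall x, phi x = f (psi x).
Proof.
move=> inj_f im.
have [//||y|psi psiP] := @linear_of_rel X A (fun x y => phi x = f y).
- by move=> a x y x' y' e e'; rewrite !linearP e e'.
- by rewrite !linear0 => /esym; rewrite -(linear0 f) => /inj_f.
by exists psi.
Qed.

(** The kernel of [f - g] on the product. The elementwise form of the universal property is the one
    used in diagram chases. *)
Lemma pullback_exists A B C (f : {linear A -> C}) (g : {linear B -> C}) :
  exists (E : lmodType R) (p : {linear E -> A}) (q : {linear E -> B}),
    [/\ forall e, f (p e) = g (q e),
        forall a b, f a = g b -> exists e, p e = a /\ q e = b
      & forall e, p e = 0 -> q e = 0 -> e = 0].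
Proof.
have lin_h : linear (fun ab : (A * B)%type => f ab.1 - g ab.2).
  by move=> a x y; rewrite /= !linearP /= scalerDr addrACA.
pose h : {linear (A * B)%type -> C} := mk_linear lin_h.
have lin1 : linear (fun e : Ker h => (val e).1) by [].
have lin2 : linear (fun e : Ker h => (val e).2) by [].
exists (Ker h), (mk_linear lin1), (mk_linear lin2); split=> /=.
- by case=> [[a b]] /= /eqP /subr0_eq.
- move=> a b fg; have Kab : (a, b) \in ker_pred h by rewrite inE /= fg subrr.
  by exists (Sub (a, b) Kab).
- by case=> [[a b] Kab] /= a0 b0; apply: val_inj; rewrite /= a0 b0.
Qed.

Lemma isomorphic_sym A B : isomorphic A B -> isomorphic B A.
Proof.
move=> [f [g fK gK]]; have lin_g : linear g.
  by move=> a x y; apply: (can_inj fK); rewrite linearP !gK.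
by exists (mk_linear lin_g), f.
Qed.

Lemma isomorphic_refl A : isomorphic A A.
Proof. by exists idfun, idfun. Qed.

Lemma isomorphic_trans A B C : isomorphic A B -> isomorphic B C -> isomorphic A C.
Proof. by move=> [f bf] [g bg]; exists (g \o f); apply: bij_comp. Qed.

Lemma isomorphicP A B : isomorphic A B <->
  exists (f : {linear A -> B}) (g : {linear B -> A}), cancel f g /\ cancel g f.
Proof.
split=> [[f [g fK gK]]|[f [g [fK gK]]]]; last by exists f, g.
have lin_g : linear g.
  by move=> a x y; apply: (can_inj fK); rewrite linearP !gK.
by exists f, (mk_linear lin_g).
Qed.

Lemma iso_of_inj_surj A B (f : {linear A -> B}) :
  injective f -> surjective f -> isomorphic A B.
Proof.
move=> inj_f /boolp.choice [g gP]; exists f, g => // x.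
by apply: inj_f; rewrite -gP.
Qed.

End LinearMaps.

(** * Vanishing of Ext and dimension shifting *)

Section Ext.
Variable R : pzRingType.
Implicit Types A B C J K M P Q X Y Z : lmodType R.

Lemma exact_comp0 A B C (f : {linear A -> B}) (g : {linear B -> C}) x :
  exact_at f g -> g (f x) = 0.
Proof. by move=> ex; apply/ex; exists x. Qed.

(** Vanishing of Ext^1 without choosing a resolution: every extension of [X] lets maps into [Y]
    extend from its kernel. With [phi] the identity this is splitting. *)
Definition Ext1 X Y : Prop :=
  forall A B (f : {linear A -> B}) (g : {linear B -> X}), short_exact f g ->
  forall phi : {linear A -> Y}, exists psi : {linear B -> Y},
    forall x, phi x = psi (f x).

(** Pullback does not change kernels, so the pullback of a short exact sequence is again one with
    the same left end. *)
Lemma pullback_kernel A B C K (f : {linear A -> C}) (g : {linear B -> C})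
    (E : lmodType R) (p : {linear E -> A}) (q : {linear E -> B})
    (k : {linear K -> B}) :
    (forall e, f (p e) = g (q e)) ->
    (forall a b, f a = g b -> exists e, p e = a /\ q e = b) ->
    (forall e, p e = 0 -> q e = 0 -> e = 0) ->
    injective k -> exact_at k g ->
  exists i : {linear K -> E},
    [/\ injective i, exact_at i p & forall x, q (i x) = k x].
Proof.
move=> sq lift jinj inj_k ex.
have [x|a x y x' y' [px qx] [px' qx']|e [pe qe]|i iP] :=
    @linear_of_rel R K E (fun x e => p e = 0 /\ q e = k x).
- by apply: lift; rewrite linear0 exact_comp0.
- by rewrite !linearP px qx px' qx' scaler0 addr0.
- by apply: jinj => //; rewrite qe linear0.
exists i; split=> [x y ixy|e|x]; last by case: (iP x).
- by apply: inj_k; rewrite -(iP x).2 -(iP y).2 ixy.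
- split=> [pe|[x ->]]; last by case: (iP x).
  have [x qx] : exists x, q e = k x by apply/ex; rewrite -sq pe linear0.
  exists x; apply/eqP; rewrite -subr_eq0; apply/eqP/jinj.
    by rewrite linearB pe (iP x).1 subrr.
  by rewrite linearB qx (iP x).2 subrr.
Qed.

Lemma Ext1_lift X Y B C (u : {linear Y -> B}) (v : {linear B -> C})
    (h : {linear X -> C}) : Ext1 X Y -> short_exact u v ->
  exists h' : {linear X -> B}, forall x, h x = v (h' x).
Proof.
move=> ext [inj_u ex sv].
have [E [p [q [sq lift jinj]]]] := pullback_exists h v.
have [i [inj_i ex_i qi]] := pullback_kernel sq lift jinj inj_u ex.
have sp : surjective p.
  by move=> x; have [b hb] := sv (h x); have [e [<- _]] := lift _ _ hb; exists e.
have [r rP] := ext _ _ _ _ (And3 inj_i ex_i sp) idfun.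
(* The retraction [r] splits the pulled-back sequence: correcting [q e] by [u (r e)] removes the
   dependence on the choice of [e] above [x]. *)
have [x|a x y x' y' [e [<- ->]] [e' [<- ->]]|b [e [pe ->]]|h' h'P] :=
    @linear_of_rel R X B (fun x b => exists e, p e = x /\ b = q e - u (r e)).
- by have [e pe] := sp x; exists (q e - u (r e)), e.
- by exists (a *: e + e'); rewrite !linearP /= scalerDr addrACA.
- have [y ->] : exists y, e = i y by apply/ex_i.
  by rewrite qi -rP /= subrr.
exists h' => x; have [e [<- ->]] := h'P x.
by rewrite linearB sq (exact_comp0 _ ex) subr0.
Qed.

(** The piece Hom(X,Q) -> Hom(X,Z) -> Ext^1(X,Y) -> Ext^1(X,Q) of the long exact sequence: extend
    [phi] into [Q], then subtract a lift of the induced map from [X] to [Z] to land in [Y]. *)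
Lemma Ext1_of_lift X Y Q Z (u : {linear Y -> Q}) (v : {linear Q -> Z}) :
    short_exact u v -> Ext1 X Q ->
    (forall h : {linear X -> Z}, exists h' : {linear X -> Q},
       forall x, h x = v (h' x)) ->
  Ext1 X Y.
Proof.
move=> [inj_u ex sv] extQ lift A B f g [inj_f ex_fg sg] phi.
have [chi chiP] := extQ _ _ _ _ (And3 inj_f ex_fg sg) (u \o phi).
have [b gb0|h hP] := @factor_surj R B X Z g (v \o chi) sg.
  have [x ->] : exists x, b = f x by apply/ex_fg.
  by rewrite /= -chiP /= (exact_comp0 _ ex).
have [h' h'P] := lift h.
have [b|psi psiP] := @factor_inj R Y Q B u (chi \- (h' \o g)) inj_u.
  by apply/ex; rewrite /= linearB -h'P -hP /= subrr.
exists psi => x; apply: inj_u; rewrite -psiP /= -chiP /=.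
by rewrite (exact_comp0 _ ex_fg) linear0 subr0.
Qed.

(** The piece Hom(P,Y) -> Hom(Z,Y) -> Ext^1(X,Y) -> Ext^1(P,Y). The pullback [E] of [g] and [b] is
    an extension of [P] by [A] and of [B] by [Z]: extend [phi] to [E] along the first, then correct
    it by a map on [P] so that it kills [Z] and descends to [B]. *)
Lemma Ext1_of_extend X Y P Z (f : {linear Z -> P}) (g : {linear P -> X}) :
    short_exact f g -> Ext1 P Y ->
    (forall phi : {linear Z -> Y}, exists psi : {linear P -> Y},
       forall x, phi x = psi (f x)) ->
  Ext1 X Y.
Proof.
move=> [inj_f ex sg] extP extend A B a b [inj_a ex_ab sb] phi.
have [E [p [q [sq lift jinj]]]] := pullback_exists g b.
have [i [inj_i ex_i qi]] := pullback_kernel sq lift jinj inj_a ex_ab.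
have sq' e : b (q e) = g (p e) by rewrite sq.
have lift' y x : b y = g x -> exists e, q e = y /\ p e = x.
  by move=> e; have [z [? ?]] := lift _ _ (esym e); exists z.
have jinj' e : q e = 0 -> p e = 0 -> e = 0 by move=> ? ?; apply: jinj.
have [j [inj_j ex_j pj]] := pullback_kernel sq' lift' jinj' inj_f ex.
have sp : surjective p.
  by move=> x; have [y hy] := sb (g x); have [e [<- _]] := lift _ _ hy; exists e.
have sQ : surjective q.
  by move=> x; have [y hy] := sg (b x); have [e [<- _]] := lift' _ _ hy; exists e.
have [psi psiP] := extP _ _ _ _ (And3 inj_i ex_i sp) phi.
have [chi chiP] := extend (psi \o j).
have [e qe0|theta thetaP] := @factor_surj R E B Y q (psi \- (chi \o p)) sQ.
  have [z ->] : exists z, e = j z by apply/ex_j.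
  by rewrite /= pj -chiP /= subrr.
exists theta => x; rewrite -qi -thetaP /= -psiP.
by rewrite (exact_comp0 _ ex_i) linear0 subr0.
Qed.

Lemma Ext1_projective X Y : projective X -> Ext1 X Y.
Proof.
move=> projX A B f g [inj_f ex sg] phi.
have [s sP] := projX _ _ g idfun sg.
have [b|r rP] := @factor_inj R A B B f (idfun \- (s \o g)) inj_f.
  by apply/ex; rewrite /= linearB -sP subrr.
exists (phi \o r) => x /=; congr (phi _); apply: inj_f.
by rewrite -rP /= (exact_comp0 _ ex) linear0 subr0.
Qed.

Lemma Ext1_injective X Y : injective_mod Y -> Ext1 X Y.
Proof. by move=> injY A B f g [inj_f _ _] phi; apply: injY. Qed.

Lemma Ext1_retractr X Y Z (i : {linear Z -> Y}) (r : {linear Y -> Z}) :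
  cancel i r -> Ext1 X Y -> Ext1 X Z.
Proof.
move=> iK ext A B f g ex phi; have [psi psiP] := ext _ _ _ _ ex (i \o phi).
by exists (r \o psi) => x; rewrite /= -psiP /= iK.
Qed.

Lemma Ext1_isol X X' Y : isomorphic X X' -> Ext1 X Y -> Ext1 X' Y.
Proof.
move=> /isomorphicP [f [g [fK gK]]] ext A B a b [inj_a ex sb].
apply: (ext _ _ a (g \o b)); split=> //.
- move=> y; rewrite -ex /=; split=> [e|->]; last by rewrite linear0.
  by rewrite -[LHS]gK e linear0.
- by move=> x; have [y e] := sb (f x); exists y; rewrite /= -e fK.
Qed.

Lemma Ext1_isor X Y Y' : isomorphic Y Y' -> Ext1 X Y -> Ext1 X Y'.
Proof. by move=> /isomorphicP [f [g [fK gK]]]; apply: Ext1_retractr gK. Qed.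

Section Balance.
Variables (X2 P X Y Q Y2 : lmodType R).
Variables (f : {linear X2 -> P}) (g : {linear P -> X}).
Variables (u : {linear Y -> Q}) (v : {linear Q -> Y2}).
Hypotheses (fg : short_exact f g) (uv : short_exact u v).

(** With [P] projective and [Q] injective both sides of the shift are Ext^2(X,Y). Only the vanishing
    actually needed is assumed, so the shift also applies to other middle terms. *)
Lemma Ext1_shift_up : Ext1 X2 Y -> Ext1 X Q -> Ext1 P Y2 -> Ext1 X Y2.
Proof.
move=> ext1 ext2 ext3; apply: Ext1_of_extend fg ext3 _ => phi.
have [h hP] := Ext1_lift phi ext1 uv.
have [h' h'P] := ext2 _ _ _ _ fg h.
by exists (v \o h') => x; rewrite /= hP h'P.
Qed.

Lemma Ext1_shift_down : Ext1 X Y2 -> Ext1 P Y -> Ext1 X2 Q -> Ext1 X2 Y.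
Proof.
move=> ext1 ext2 ext3; apply: Ext1_of_lift uv ext3 _ => phi.
have [h hP] := ext1 _ _ _ _ fg phi.
have [h' h'P] := Ext1_lift h ext2 uv.
by exists (h' \o f) => x; rewrite /= hP h'P.
Qed.

End Balance.

Definition pstep X K : Prop :=
  exists P (f : {linear K -> P}) (g : {linear P -> X}),
    projective P /\ short_exact f g.

Definition istep Y Z : Prop :=
  exists J (u : {linear Y -> J}) (v : {linear J -> Z}),
    injective_mod J /\ short_exact u v.

(* Unlike [syzygy], these use arbitrary projectives and injectives, and [psyz]
   appends its steps at the syzygy end; [Ext1_balance] trades the last step of
   the one against the first step of the other. *)
Fixpoint psyz (i : nat) X K : Prop :=
  if i is i'.+1 then exists2 Z, psyz i' X Z & pstep Z K else isomorphic X K.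

Fixpoint icosyz (i : nat) Y Z : Prop :=
  if i is i'.+1 then exists2 W : lmodType R, istep Y W & icosyz i' W Z
  else isomorphic Y Z.

Lemma pstep_isor X K K' : isomorphic K K' -> pstep X K -> pstep X K'.
Proof.
move=> /isomorphicP [a [b [aK bK]]] [P [f [g [projP [inj_f ex sg]]]]].
exists P, (f \o b), g; split=> //; split=> //.
  by apply: inj_comp => //; apply: can_inj bK.
move=> y; rewrite ex; split=> [[x ->]|[x ->]]; last by exists (b x).
by exists (a x); rewrite /= aK.
Qed.

Lemma istep_isol Y Y' Z : isomorphic Y Y' -> istep Y' Z -> istep Y Z.
Proof.
move=> /isomorphicP [a [b [aK bK]]] [P [f [g [projP [inj_f ex sg]]]]].
exists P, (f \o a), g; split=> //; split=> //.
  by apply: inj_comp => //; apply: can_inj aK.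
move=> y; rewrite ex; split=> [[x ->]|[x ->]]; last by exists (a x).
by exists (b x); rewrite /= bK.
Qed.

Lemma psyz_cat i j X K M : psyz i X K -> psyz j K M -> psyz (i + j) X M.
Proof.
move=> XK; elim: j M => [|j IHj] M /=; last first.
  by move=> [Z KZ ZM]; rewrite addnS /=; exists Z => //; apply: IHj.
rewrite addn0; case: i XK => [|i] /=; first exact: isomorphic_trans.
by move=> [Z XZ ZK] KM; exists Z => //; apply: pstep_isor KM ZK.
Qed.

Lemma psyz_split i j X M :
  psyz (i + j) X M -> exists2 K, psyz i X K & psyz j K M.
Proof.
elim: j M => [|j IHj] M.
  by rewrite addn0 => XM; exists M => //; apply: isomorphic_refl.
by rewrite addnS /= => -[Z /IHj [K XK KZ] ZM]; exists K => //; exists Z.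
Qed.

Lemma psyz1 X K : pstep X K -> psyz 1 X K.
Proof. by move=> XK; exists X => //; apply: isomorphic_refl. Qed.

Lemma icosyz_cat i j X K M : icosyz i X K -> icosyz j K M -> icosyz (i + j) X M.
Proof.
elim: i X => [|i IHi] X /=; last first.
  by move=> [W XW WK] KM; exists W => //; apply: IHi.
case: j => [|j] XK /=; first exact: isomorphic_trans.
by move=> [W KW WM]; exists W => //; apply: istep_isol XK KW.
Qed.

Lemma icosyz1 Y Z : istep Y Z -> icosyz 1 Y Z.
Proof. by move=> YZ; exists Z => //; apply: isomorphic_refl. Qed.

(** Ext^(i+1)(X,Y) can be computed by resolving either argument. Each induction step moves one
    syzygy on the left to one cosyzygy on the right, both groups being an Ext^2. *)
Lemma Ext1_balance i X K Y Z :
  psyz i X K -> icosyz i Y Z -> Ext1 K Y <-> Ext1 X Z.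
Proof.
elim: i K Y => [|i IHi] K Y /=.
  move=> XK YZ; split=> ext.
    by apply: Ext1_isor YZ _; apply: Ext1_isol ext; apply: isomorphic_sym.
  by apply: Ext1_isol XK _; apply: Ext1_isor ext; apply: isomorphic_sym.
move=> [K1 XK1 [P [f [g [projP fg]]]]] [W [J [u [v [injJ uv]]]] WZ].
rewrite -(IHi _ _ XK1 WZ); split=> ext.
  by apply: Ext1_shift_up fg uv ext _ _;
    [apply: Ext1_injective | apply: Ext1_projective].
by apply: Ext1_shift_down fg uv ext _ _;
  [apply: Ext1_projective | apply: Ext1_injective].
Qed.

Lemma injdim_icosyz d Y : injdim_le d Y ->
  exists2 Z, icosyz d Y Z & injective_mod Z.
Proof.
elim: d Y => [|d IHd] Y /=; first by exists Y => //; apply: isomorphic_refl.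
move=> [J [C [f [g [injJ fg /IHd [Z CZ injZ]]]]]].
by exists Z => //; exists C => //; exists J, f, g.
Qed.

(** Only the last [d] of the [m] syzygy steps are traded; they turn [Y] into an injective. *)
Lemma injdim_Ext1 d m X K Y :
  (d <= m)%N -> injdim_le d Y -> psyz m X K -> Ext1 K Y.
Proof.
move=> /subnK <- /injdim_icosyz [Z YZ injZ] /psyz_split [K1 _ K1K].
by apply/(Ext1_balance K1K YZ); apply: Ext1_injective.
Qed.

(* [Ext_zero i X Y] says that Ext^(i+1)(X, Y) = 0. *)
Definition Ext_zero (i : nat) X Y : Prop := forall K, psyz i X K -> Ext1 K Y.

Lemma Ext_zero_projective i X Y : projective X -> Ext_zero i X Y.
Proof.
move=> projX; have ext K : psyz i X K -> projective K.
  elim: i K => [|i IHi] K /=.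
    move=> /isomorphicP [a [b [aK bK]]] A B p g sp.
    have [h hP] := projX _ _ p (g \o a) sp.
    by exists (h \o b) => x; rewrite /= -hP /= bK.
  move=> [Z /IHi projZ [P [f [g [projP [inj_f ex sg]]]]]] A B p h sp.
  have [psi psiP] := Ext1_projective projZ (And3 inj_f ex sg) idfun.
  have [k kP] := projP _ _ p (h \o psi) sp.
  by exists (k \o f) => x; rewrite /= -kP /= -psiP.
by move=> K /ext; apply: Ext1_projective.
Qed.

(** Connects an arbitrary projective resolution with iterated syzygies: [P i] covers the i-th
    syzygy, with kernel the image of [d i]. *)
Lemma resolution_psyz X (P : nat -> lmodType R)
    (d : forall i, {linear P i.+1 -> P i}) (e : {linear P 0%N -> X}) i :
  proj_resolution d e -> exists Z (g : {linear P i -> Z}),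
    [/\ psyz i X Z, surjective g & exact_at (d i) g].
Proof.
move=> [projP se ex0 ex]; elim: i => [|i [Z [g [XZ sg exg]]]].
  by exists X, e; split=> //; apply: isomorphic_refl.
have gd0 x : g (d i x) = 0 by apply: exact_comp0.
exists (Ker g), (ker_lift gd0); split.
- exists Z => //; exists (P i), (ker_incl g), g; split=> //.
  exact: ker_short_exact.
- case=> y Ky; have [x yx] : exists x, y = d i x by apply/exg/eqP.
  by exists x; apply: val_inj.
- move=> y; rewrite -ex; split=> [/(congr1 val) //|dy0]; exact: val_inj.
Qed.

End Ext.

(** * Finitely generated modules *)

Section FinGen.
Variable R : pzRingType.
Implicit Types A B C J K M P Q X Y Z : lmodType R.

(** Submodules are represented by injective maps. This and [enough_fg_injectives] are all that the
    dimension shifting below needs to know about the ring. *)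
Definition noetherian : Prop :=
  forall A B (f : {linear A -> B}), injective f -> fin_gen B -> fin_gen A.

Definition enough_fg_injectives : Prop :=
  forall X, fin_gen X ->
  exists J (f : {linear X -> J}), fg_injective J /\ injective f.

Lemma fin_gen_surj A B (f : {linear A -> B}) :
  surjective f -> fin_gen A -> fin_gen B.
Proof.
move=> sf [m [e eP]]; exists m, (f \o e) => y; have [x ->] := sf y.
have [c ->] := eP x; exists c; rewrite linear_sum.
by apply: eq_bigr => i _; rewrite linearZ.
Qed.

Lemma fin_gen_iso A B : isomorphic A B -> fin_gen A -> fin_gen B.
Proof.
by move=> [f [g fK gK]]; apply: (@fin_gen_surj _ _ f) => y; exists (g y).
Qed.

Lemma fin_gen_prod A B : fin_gen A -> fin_gen B -> fin_gen (A * B)%type.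
Proof.
move=> [m [e eP]] [n [f fP]].
exists (m + n)%N, (fun i => match split i with inl j => (e j, 0) | inr j => (0,
  f j) end).
case=> x y; have [a ->] := eP x; have [b ->] := fP y.
exists (fun i => match split i with inl j => a j | inr j => b j end).
rewrite big_split_ord.
transitivity (\sum_i a i *: (e i, 0 : B) + \sum_j b j *: (0 : A, f j)); last first.
  by congr (_ + _); apply: eq_bigr => i _;
    rewrite (unsplitK (inl i) : split (lshift n i) = inl i) ||
    rewrite (unsplitK (inr i) : split (rshift m i) = inr i).
rewrite [RHS]surjective_pairing; congr (_, _).
- by rewrite linearD !raddf_sum /= [X in _ + X]big1 ?addr0 // => i _;
    rewrite scaler0.
- by rewrite linearD !raddf_sum /= [X in X + _]big1 ?add0r // => i _;
    rewrite scaler0.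
Qed.

Definition free_mod (m : nat) : lmodType R := {ffun 'I_m -> R^o}.

Definition free_gen m (i : 'I_m) : free_mod m := [ffun j => (j == i)%:R].

Lemma free_modE m (x : free_mod m) : x = \sum_i (x i : R) *: free_gen i.
Proof.
apply/ffunP => j; rewrite sum_ffunE (bigD1 j) //= big1 ?addr0 => [|i ij].
  by rewrite !ffunE eqxx; rewrite /GRing.scale /= mulr1.
by rewrite !ffunE eq_sym (negPf ij); rewrite /GRing.scale /= mulr0.
Qed.

Lemma free_mod_fin_gen m : fin_gen (free_mod m).
Proof.
by exists m, (@free_gen m) => x; exists x; apply: free_modE.
Qed.

Lemma free_mod_hom m X (e : 'I_m -> X) :
  exists f : {linear free_mod m -> X},
    (forall i, f (free_gen i) = e i) /\ forall x, f x = \sum_i (x i : R) *: e i.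
Proof.
have lin_f : linear (fun x : free_mod m => \sum_i (x i : R) *: e i).
  move=> a x y; rewrite scaler_sumr -big_split /=; apply: eq_bigr => i _.
  by rewrite !ffunE scalerDl scalerA.
exists (mk_linear lin_f); split=> // i /=.
rewrite (bigD1 i) //= big1 ?addr0 ?ffunE ?eqxx ?scale1r // => j ji.
by rewrite ffunE (negPf ji) scale0r.
Qed.

Lemma free_mod_ext m X (f g : {linear free_mod m -> X}) :
  (forall i, f (free_gen i) = g (free_gen i)) -> f =1 g.
Proof.
move=> fg x; rewrite (free_modE x) !linear_sum; apply: eq_bigr => i _.
by rewrite !linearZ fg.
Qed.

Lemma free_mod_projective m : projective (free_mod m).
Proof.
move=> A B p g sp.
have [a aP] := boolp.choice (fun i : 'I_m => sp (g (free_gen i))).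
have [h [hP _]] := free_mod_hom a; exists h.
by apply: (@free_mod_ext m B g (p \o h)) => i; rewrite /= hP.
Qed.

Lemma free_mod_fg_projective m : fg_projective (free_mod m).
Proof. by split; [apply: free_mod_fin_gen | apply: free_mod_projective]. Qed.

Lemma regular_fg_projective : fg_projective (R^o : lmodType R).
Proof.
split.
  exists 1%N, (fun=> 1) => y; exists (fun=> y).
  by rewrite big_ord1 /GRing.scale /= mulr1.
move=> A B p g sp; have [a ga] := sp (g 1).
have lin_h : linear (fun r : R^o => (r : R) *: a).
  by move=> r x y; rewrite scalerDl scalerA.
by exists (mk_linear lin_h) => r;
  rewrite /= linearZ -ga -linearZ /GRing.scale /= mulr1.
Qed.

Lemma free_cover X : fin_gen X ->
  exists m (p : {linear free_mod m -> X}), surjective p.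
Proof.
move=> [m [e eP]]; have [p [_ pE]] := free_mod_hom e; exists m, p => x.
by have [c ->] := eP x; exists [ffun i => c i]; rewrite pE; apply: eq_bigr => i _;
  rewrite ffunE.
Qed.

Lemma fg_projective_cover X : fin_gen X ->
  exists P (p : {linear P -> X}), fg_projective P /\ surjective p.
Proof.
move=> /free_cover [m [p sp]]; exists (free_mod m), p; split=> //.
exact: free_mod_fg_projective.
Qed.

Lemma fg_projective_retract P : fg_projective P ->
  exists m (i : {linear P -> free_mod m}) (r : {linear free_mod m -> P}),
    cancel i r.
Proof.
move=> [fgP projP]; have [m [p sp]] := free_cover fgP.
by have [i iP] := projP _ _ p idfun sp; exists m, i, p => x; rewrite -iP.
Qed.

Lemma fg_projective_prod A B :
  fg_projective A -> fg_projective B -> fg_projective (A * B)%type.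
Proof.
move=> [fA pA] [fB pB]; split; first exact: fin_gen_prod.
move=> C D p g sp.
have lin1 : linear (fun x : A => (x, 0 : B)).
  by move=> a x y; rewrite [RHS]surjective_pairing /= scaler0 addr0.
have lin2 : linear (fun y : B => (0 : A, y)).
  by move=> a x y; rewrite [RHS]surjective_pairing /= scaler0 addr0.
have [h hP] := pA _ _ p (g \o mk_linear lin1) sp.
have [k kP] := pB _ _ p (g \o mk_linear lin2) sp.
exists ((h \o fst) \+ (k \o snd)) => -[x y] /=.
rewrite linearD -hP -kP /= -linearD.
congr (g _); rewrite [RHS]surjective_pairing /=.
by rewrite addr0 add0r.
Qed.

Lemma fg_injective_prod A B :
  fg_injective A -> fg_injective B -> fg_injective (A * B)%type.
Proof.
move=> [fA iA] [fB iB]; split; first exact: fin_gen_prod.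
move=> C D i g inj_i.
have [h hP] := iA _ _ i (fst \o g) inj_i.
have [k kP] := iB _ _ i (snd \o g) inj_i.
have lin_f : linear (fun y => (h y, k y)).
  by move=> a x y; rewrite !linearP.
by exists (mk_linear lin_f) => x; rewrite /= -hP -kP; apply: surjective_pairing.
Qed.

Lemma Ext1_free_mod X m : Ext1 X R^o -> Ext1 X (free_mod m).
Proof.
move=> ext A B f g ex phi.
have lin_i i : linear (fun x : free_mod m => x i : R^o) by move=> a x y;
  rewrite !ffunE.
have [psi psiP] := boolp.choice (fun i => ext _ _ _ _ ex (mk_linear (lin_i i) \o
  phi)).
have lin_psi : linear (fun y => [ffun i => psi i y] : free_mod m).
  by move=> a x y; apply/ffunP => i; rewrite !ffunE linearP.
by exists (mk_linear lin_psi) => x; apply/ffunP => i; rewrite ffunE -psiP.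
Qed.

(** [Q] is a retract of a finite free module, where the vanishing is checked coordinatewise. *)
Lemma Ext1_fg_projective X Q : fg_projective Q -> Ext1 X R^o -> Ext1 X Q.
Proof.
move=> /fg_projective_retract [m [i [r iK]]] ext.
by apply: (Ext1_retractr iK); apply: Ext1_free_mod.
Qed.

Lemma syzygy_psyz k X K : syzygy k X K -> psyz k X K.
Proof.
elim: k X => [|k IHk] X //= [P [p [[_ projP] sp /IHk KK]]].
apply: (@psyz_cat _ 1%N k _ (Ker p)) KK; apply: psyz1.
by exists P, (ker_incl p), p; split=> //; apply: ker_short_exact.
Qed.

Lemma cosyzygy_icosyz k X K : cosyzygy k X K -> icosyz k X K.
Proof.
elim: k X => [|k IHk] X //= [I [C [f [g [[_ injI] fg /IHk CK]]]]].
by exists C => //; exists I, f, g.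
Qed.

Lemma cosyzygy_fin_gen k X K : fin_gen X -> cosyzygy k X K -> fin_gen K.
Proof.
elim: k X => [|k IHk] X fX /=; first by move=> /fin_gen_iso; apply.
move=> [I [C [f [g [[fI _] [_ _ sg] CK]]]]]; apply: IHk CK.
exact: fin_gen_surj fI.
Qed.

Hypothesis noeth : noetherian.

Lemma syzygy_fin_gen k X K : fin_gen X -> syzygy k X K -> fin_gen K.
Proof.
elim: k X => [|k IHk] X fX /=; first by move=> /fin_gen_iso; apply.
move=> [P [p [[fP _] sp KK]]]; apply: IHk KK.
exact: noeth (@ker_incl_inj _ _ _ p) fP.
Qed.

Lemma syzygy_exists k X : fin_gen X -> exists K, syzygy k X K.
Proof.
elim: k X => [|k IHk] X fX; first by exists X; apply: isomorphic_refl.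
have [P [p [fgP sp]]] := fg_projective_cover fX.
have [|K KK] := IHk (Ker p); first exact: noeth (@ker_incl_inj _ _ _ p) fgP.1.
by exists K, P, p.
Qed.

Lemma psyz_exists k X : fin_gen X -> exists2 K, psyz k X K & fin_gen K.
Proof.
move=> fX; have [K XK] := syzygy_exists k fX.
by exists K; [apply: syzygy_psyz | apply: syzygy_fin_gen XK].
Qed.

Hypothesis enough_inj : enough_fg_injectives.

Lemma cosyzygy_exists k X : fin_gen X -> exists K, cosyzygy k X K.
Proof.
elim: k X => [|k IHk] X fX; first by exists X; apply: isomorphic_refl.
have [J [f [fgJ inj_f]]] := enough_inj fX.
have [C [g fg]] := cokernel_exists inj_f; have [_ _ sg] := fg.
have [|K CK] := IHk C; first exact: fin_gen_surj sg fgJ.1.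
by exists K, J, C, f, g.
Qed.

Lemma icosyz_exists k X : fin_gen X -> exists2 K, icosyz k X K & fin_gen K.
Proof.
move=> fX; have [K XK] := cosyzygy_exists k fX.
by exists K; [apply: cosyzygy_icosyz | apply: cosyzygy_fin_gen XK].
Qed.

(** One syzygy decides for all of them: by [Ext1_balance] each is equivalent to the same condition
    on a cosyzygy of [Y]. *)
Lemma Ext_zero_psyz i X K Y : fin_gen Y -> psyz i X K ->
  Ext1 K Y <-> Ext_zero i X Y.
Proof.
move=> fY XK; split=> [ext K' XK'|]; last by apply.
have [Z YZ _] := icosyz_exists i fY.
by apply/(Ext1_balance XK' YZ)/(Ext1_balance XK YZ).
Qed.

Lemma Ext_zero_icosyz i X Y Z : fin_gen X -> fin_gen Y -> icosyz i Y Z ->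
  Ext1 X Z <-> Ext_zero i X Y.
Proof.
move=> fX fY YZ; have [K XK _] := psyz_exists i fX.
by rewrite -(Ext1_balance XK YZ); apply: Ext_zero_psyz.
Qed.

Lemma Ext_zero_shiftl i j X K Y : fin_gen K -> fin_gen Y -> psyz j X K ->
  Ext_zero (j + i) X Y <-> Ext_zero i K Y.
Proof.
move=> fK fY XK; split=> ext; first by move=> M KM; apply: ext; apply: psyz_cat KM.
have [M KM _] := psyz_exists i fK.
by apply/(Ext_zero_psyz fY (psyz_cat XK KM)); apply: ext.
Qed.

Lemma Ext_zero_shiftr i j X Y Z :
    fin_gen X -> fin_gen Y -> fin_gen Z -> icosyz j Y Z ->
  Ext_zero (j + i) X Y <-> Ext_zero i X Z.
Proof.
move=> fX fY fZ YZ; have [W ZW _] := icosyz_exists i fZ.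
rewrite -(Ext_zero_icosyz fX fZ ZW).
by rewrite (Ext_zero_icosyz fX fY (icosyz_cat YZ ZW)).
Qed.

(** Dimension shift in the second argument along a middle term that need not be injective, only
    acyclic for Hom(X,-). *)
Lemma Ext_zero_dimshiftr i X Y Q Z (u : {linear Y -> Q}) (v : {linear Q -> Z}) :
    fin_gen X -> fin_gen Y -> fin_gen Z -> short_exact u v ->
    (forall j, Ext_zero j X Q) ->
  Ext_zero i X Z <-> Ext_zero i.+1 X Y.
Proof.
move=> fX fY fZ uv ext; have [K XK fK] := psyz_exists i fX.
have [P [p [[_ projP] sp]]] := fg_projective_cover fK.
have fg := ker_short_exact sp.
have XK' : psyz i.+1 X (Ker p) by exists K => //; exists P, (ker_incl p), p.
have extP := fun Y => @Ext1_projective R P Y projP.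
rewrite -(Ext_zero_psyz fZ XK) -(Ext_zero_psyz fY XK'); split=> e.
  by apply: Ext1_shift_down fg uv e _ _ => //; apply: ext XK'.
by apply: Ext1_shift_up fg uv e _ _ => //; apply: ext XK.
Qed.

Lemma Ext_zero_dimshiftl i X Y P K (f : {linear K -> P}) (g : {linear P -> X}) :
    fin_gen X -> fin_gen Y -> fin_gen P -> fin_gen K -> short_exact f g ->
    (forall j, Ext_zero j P Y) ->
  Ext_zero i K Y <-> Ext_zero i.+1 X Y.
Proof.
move=> fX fY fP fK fg ext; have [Z YZ fZ] := icosyz_exists i fY.
have [J [u [[_ injJ] inj_u]]] := enough_inj fZ.
have [W [v uv]] := cokernel_exists inj_u.
have YW : icosyz i.+1 Y W.
  by rewrite -addn1; apply: icosyz_cat YZ _; apply: icosyz1; exists J, u, v.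
rewrite -(Ext_zero_icosyz fK fY YZ) -(Ext_zero_icosyz fX fY YW).
have extJ := fun X => @Ext1_injective R X J injJ; split=> e.
  by apply: Ext1_shift_up fg uv e _ _ => //; apply/(Ext_zero_icosyz fP fY YW).
by apply: Ext1_shift_down fg uv e _ _ => //; apply/(Ext_zero_icosyz fP fY YZ).
Qed.

Lemma free_resolution_exists X : fin_gen X ->
  exists (P : nat -> lmodType R) (d : forall i, {linear P i.+1 -> P i})
    (e : {linear P 0%N -> X}),
  proj_resolution d e /\
  forall i, exists (K L : lmodType R) (p : {linear P i.+1 -> K}) (f : {linear K ->
    P i})
    (g : {linear P i -> L}),
    [/\ psyz i X L, surjective p, short_exact f g & forall x, d i x = f (p x)].
Proof.
(* Bundling modules with their finite generation makes the choice of a next syzygy a function that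
   can be iterated. *)
move=> fX; pose T := {M : lmodType R | fin_gen M}.
have stepT (s : T) : exists t : T, exists P (f : {linear sval t -> P})
    (g : {linear P -> sval s}), projective P /\ short_exact f g.
  case: s => M fM; have [P [p [[fP projP] sp]]] := fg_projective_cover fM.
  exists (exist (@fin_gen R) (Ker p : lmodType R) (noeth (@ker_incl_inj _ _ _ p)
    fP)).
  by exists P, (ker_incl p), p; split=> //; apply: ker_short_exact.
have [next nextP] := boolp.choice stepT.
pose s i := iter i next (exist (@fin_gen R) X fX).
have stepP i := cid (nextP (s i)).
pose P i := sval (stepP i).
have fP i := cid (svalP (stepP i)).
pose f i : {linear sval (s i.+1) -> P i} := sval (fP i).
have gP i := cid (svalP (fP i)).
pose g i : {linear P i -> sval (s i)} := sval (gP i).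
have projP i : projective (P i) by case: (svalP (gP i)).
have fg i : short_exact (f i) (g i) by case: (svalP (gP i)).
have sg i : surjective (g i) by case: (fg i).
have Xs i : psyz i X (sval (s i)).
  elim: i => [|i IHi]; first exact: isomorphic_refl.
  by exists (sval (s i)) => //; exists (P i), (f i), (g i).
exists P, (fun i => f i \o g i.+1), (g 0%N); split; last first.
  by move=> i; exists (sval (s i.+1)), (sval (s i)), (g i.+1), (f i), (g i).
have ex i : exact_at (f i \o g i.+1) (g i).
  have [_ ex _] := fg i; move=> y; rewrite ex.
  split=> [[z ->]|[x ->]]; last by exists (g i.+1 x).
  by have [x ->] := sg i.+1 z; exists x.
split=> // i y; apply: (iff_trans _ (ex i.+1 y)) => /=; split=> [|->];
  last exact: linear0.
by have [inj_f _ _] := fg i; rewrite -(linear0 (f i)) => /inj_f.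
Qed.

(** The bridge to the definition by resolutions. One resolution suffices in the forward direction,
    since one syzygy decides for all; backwards, any resolution exhibits an i-th syzygy. *)
Lemma Ext_vanishesP i X Y : fin_gen X -> fin_gen Y ->
  Ext_vanishes i.+1 X Y <-> Ext_zero i X Y.
Proof.
move=> fX fY; split=> [ext|ext P d e res].
  have [P [d [e [res /(_ i) [K [L [p [f [g [XL sp fg dE]]]]]]]]]] :=
    free_resolution_exists fX.
  apply/(Ext_zero_psyz fY XL); have [projP _ _ ex] := res.
  apply: (Ext1_of_extend fg (Ext1_projective (projP i))) => phi.
  have [|psi psiP] := ext P d e res (phi \o p).
    move=> x /=; have : d i (d i.+1 x) = 0 by apply/ex; exists x.
    have [inj_f _ _] := fg; rewrite dE -(linear0 f) => /inj_f ->.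
    by rewrite linear0.
  by exists psi => k; have [x ->] := sp k; have /= := psiP x; rewrite dE.
move=> phi phi0; have [Z [g [XZ sg ex]]] := resolution_psyz i res.
have gd0 x : g (d i x) = 0 by apply: exact_comp0.
have sd : surjective (ker_lift gd0).
  case=> y Ky; have [x yx] : exists x, y = d i x by apply/ex/eqP.
  by exists x; apply: val_inj.
have [x /(congr1 val) /= dx0|phi' phi'P] :=
  @factor_surj R _ _ _ (ker_lift gd0) phi sd.
  by have [_ _ _ /(_ i x) [/(_ dx0) [z ->] _]] := res; apply: phi0.
have [psi psiP] := ext Z XZ _ _ _ _ (ker_short_exact sg) phi'.
by exists psi => x; rewrite phi'P psiP.
Qed.

(** An embedding into a finitely generated injective has finitely generated cokernel, so it splits
    and [Y] is a retract of that injective. *)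
Lemma injective_of_Ext1 Y : fin_gen Y ->
  (forall X, fin_gen X -> Ext1 X Y) -> injective_mod Y.
Proof.
move=> fY ext; have [J [f [[fJ injJ] inj_f]]] := enough_inj fY.
have [C [g fg]] := cokernel_exists inj_f; have [_ _ sg] := fg.
have [r rP] := ext C (fin_gen_surj sg fJ) _ _ _ _ fg idfun.
move=> A B i h inj_i; have [k kP] := injJ _ _ i (f \o h) inj_i.
by exists (r \o k) => x; rewrite /= -kP /= -rP.
Qed.

End FinGen.

(** * Length and Hopkins' theorem *)

Local Open Scope classical_set_scope.

(* Groups with operators: length is measured simultaneously for modules over a
   ring and over a central subring. *)
Section Length.
Variable T : Type.

Section OneGroup.
Variables (V : zmodType) (act : T -> V -> V).
Implicit Types (S U W : set V).

Definition op_subgroup S : Prop :=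
  [/\ S 0, forall x y, S x -> S y -> S (x - y) & forall t x, S x -> S (act t x)].

(** Length without composition series: each strict descent to an operator subgroup costs one unit,
    and at 0 no strict descent is left. *)
Fixpoint length_le (n : nat) S : Prop :=
  if n is n'.+1 then
    forall U, op_subgroup U -> U `<=` S -> ~ S `<=` U -> length_le n' U
  else forall U, op_subgroup U -> U `<=` S -> S `<=` U.

Lemma op_subgroupN S x : op_subgroup S -> S x -> S (- x).
Proof. by move=> [S0 SB _] Sx; rewrite -sub0r; apply: SB. Qed.

Lemma op_subgroupD S x y : op_subgroup S -> S x -> S y -> S (x + y).
Proof.
by move=> sS Sx Sy; rewrite -[y]opprK; case: (sS) => _ + _; apply=> //;
  apply: op_subgroupN.
Qed.

Lemma op_subgroupI S U : op_subgroup S -> op_subgroup U -> op_subgroup (S `&` U).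
Proof.
move=> [S0 SB SZ] [U0 UB UZ]; split=> // [x y [Sx Ux] [Sy Uy]|t x [Sx Ux]].
  by split; [apply: SB | apply: UB].
by split; [apply: SZ | apply: UZ].
Qed.

Lemma length_leS n S : length_le n S -> length_le n.+1 S.
Proof.
elim: n S => [|n IHn] S /= lenS U sU US nSU; first by case: nSU; apply: lenS.
by apply: IHn; apply: lenS.
Qed.

Lemma length_le_leq m n S : (m <= n)%N -> length_le m S -> length_le n S.
Proof.
move=> /subnK <-; elim: (n - m)%N => //= d IHd /IHd; exact: length_leS.
Qed.

Lemma length_le_sub n S U : U `<=` S -> length_le n S -> length_le n U.
Proof.
case: n => [|n] US lenS W sW WU; last first.
  move=> nUW; apply: lenS => // [x /WU/US //|SW].
  by apply: nUW => x /US/SW.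
by move=> x /US; apply: (lenS W) => // y /WU /US.
Qed.

Lemma length_le_max n S (Phi : set V -> Prop) :
    length_le n S -> (forall U, Phi U -> op_subgroup U /\ U `<=` S) ->
    (exists U, Phi U) ->
  exists2 U, Phi U & forall W, Phi W -> U `<=` W -> W `<=` U.
Proof.
move=> lenS PhiS [U0 PhiU0].
(* [m] bounds from below the length of some member of [Phi], with 0 always allowed. At the largest
   such [m], a strictly larger member would have length at least [m.+1]. *)
pose P m := `[< exists2 U, Phi U & m = 0%N \/ ~ length_le m.-1 U >].
have exP : exists m, P m by exists 0%N; apply/asboolP; exists U0; [|left].
have leP m : P m -> (m <= n)%N.
  move=> /asboolP [U /PhiS [_ US] [-> //|nlen]].
  case: m nlen => // m /= nlen; rewrite ltnNge; apply/negP => nm; apply: nlen.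
  by apply: length_le_leq nm _; apply: length_le_sub lenS.
case: (ex_maxnP exP leP) => m /asboolP [U PhiU lenU] max.
exists U => // W PhiW UW; apply: contrapT => nWU.
suff : P m.+1 by move=> /max; rewrite ltnn.
apply/asboolP; exists W => //; right=> /= lenW; have [sU _] := PhiS _ PhiU.
case: m lenU lenW {max} => [_|m [//|nlenU]] lenW; first by apply: nWU; apply: lenW.
by apply: nlenU; apply: lenW.
Qed.

Lemma length_le_min n S (Phi : set V -> Prop) :
    length_le n S -> (forall U, Phi U -> op_subgroup U) ->
    (exists2 U, Phi U & U `<=` S) ->
  exists2 U, Phi U & forall W, Phi W -> W `<=` U -> U `<=` W.
Proof.
move=> + PhiS; elim: n S => [|n IHn] S lenS [U PhiU US].
  exists U => // W PhiW WU x /US; apply: (lenS W (PhiS _ PhiW)) => y /WU/US //.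
have [minU|] := pselect (forall W, Phi W -> W `<=` U -> U `<=` W);
  first by exists U.
move=> /existsNP [W /not_implyP [PhiW /not_implyP [WU nUW]]].
apply: (IHn W); last by exists W.
apply: lenS => //; [exact: PhiS | by move=> x /WU/US | move=> SW].
by apply: nUW => x /US/SW.
Qed.

Hypothesis actB : forall t x y, act t (x - y) = act t x - act t y.

Lemma op_subgroup_sum S U : op_subgroup S -> op_subgroup U ->
  op_subgroup [set x | exists2 y, S y & U (x - y)].
Proof.
move=> [S0 SB SZ] [U0 UB UZ]; split=> [|x y [u Su Uxu] [v Sv Uyv]|t x [u Su Uxu]].
- by exists 0; rewrite ?subr0.
- exists (u - v); first exact: SB.
  have -> : x - y - (u - v) = x - u - (y - v).
    by rewrite !opprB addrACA [RHS]addrACA (addrC (- y)).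
  exact: UB.
- by exists (act t u); [apply: SZ | rewrite -actB; apply: UZ].
Qed.

(** If [U] is not inside [W], then nothing lies strictly between [U] and its intersection with [W]:
    a subgroup [X] in between gives [W + X] between [W] and [S], and the modular law brings the
    alternative back. That intersection is strictly inside [W], so induction applies to [U]. *)
Lemma length_le_cover n S W :
    op_subgroup S -> op_subgroup W -> W `<=` S ->
    (forall U, op_subgroup U -> W `<=` U -> U `<=` S -> U `<=` W \/ S `<=` U) ->
  length_le n W -> length_le n.+1 S.
Proof.
elim: n S W => [|n IHn] S W sS sW WS maxW lenW U sU US nSU.
all: have sUW := op_subgroupI sU sW.
all: have [UW|nUW] := pselect (U `<=` W); first exact: length_le_sub lenW.
all: have nWU : ~ W `<=` U by move=> WU; case: (maxW U sU WU US).
  by case: nWU => x /(lenW _ sUW (@subIsetr _ U W)) [].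
apply: (IHn U (U `&` W) sU sUW (@subIsetl _ U W)).
  move=> X sX UWX XU; pose Z := [set x | exists2 w, W w & X (x - w)].
  have [X0 _ _] := sX; have [W0 _ _] := sW.
  have WZ : W `<=` Z by move=> w Ww; exists w; rewrite // subrr.
  have XZ : X `<=` Z by move=> x Xx; exists 0; rewrite ?subr0.
  have ZS : Z `<=` S.
    move=> x [w Ww Xxw]; rewrite -[x](subrK w); apply: op_subgroupD => //.
      exact/US/XU.
    exact: WS.
  have [ZW|SZ] := maxW Z (op_subgroup_sum sW sX) WZ ZS.
    by left=> x Xx; split; [apply: XU | apply: (ZW _ (XZ _ Xx))].
  right=> u Uu; have [w Ww Xuw] := SZ _ (US _ Uu).
  rewrite -[u](subrK w); apply: op_subgroupD => //; apply: UWX; split=> //.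
  by rewrite -[w](subKr u); have [_ UB _] := sU; apply: UB => //; apply: XU.
apply: (lenW _ sUW (@subIsetr _ U W)).
by move=> WUW; apply: nWU => x /WUW [].
Qed.

Lemma op_subgroup_zorn (W0 D : set V) :
    op_subgroup W0 -> (forall x, W0 x -> ~ D x) ->
  exists W, [/\ op_subgroup W, W0 `<=` W, forall x, W x -> ~ D x &
    forall U, op_subgroup U -> W `<=` U -> (forall x, U x -> ~ D x) -> U `<=` W].
Proof.
move=> sW0 W0D; have [W00 _ _] := sW0.
pose good (U : set V) := [/\ op_subgroup U, W0 `<=` U & forall x, U x -> ~ D x].
pose P : set (set V) := [set U | U = set0 \/ good U].
have [F FP Ftot|W [PW maxW]] := @Zorn_bigcup V P.
  have [[U1 FU1 [u1 U1u1]]|no] := pselect (exists2 U, F U & exists x, U x);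
    last first.
    left; rewrite -subset0 => x [U FU Ux]; apply: no; exists U => //; by exists x.
  have goodF U x : F U -> U x -> good U by move=> /FP [->|].
  right; split.
  - have [[U10 _ _] _ _] := goodF _ _ FU1 U1u1.
    split; first by exists U1.
      move=> x y [U FU Ux] [U' FU' U'y].
      have [UU'|U'U] := Ftot _ _ FU FU'.
        exists U' => //; have [[_ SB _] _ _] := goodF _ _ FU' U'y.
        by apply: SB => //; apply: UU'.
      exists U => //; have [[_ SB _] _ _] := goodF _ _ FU Ux.
      by apply: SB => //; apply: U'U.
    move=> t x [U FU Ux]; have [[_ _ SZ] _ _] := goodF _ _ FU Ux.
    by exists U => //; apply: SZ.
  - by have [_ W0U _] := goodF _ _ FU1 U1u1; move=> x /W0U U1x; exists U1.
  - by move=> x [U FU Ux]; have [_ _ nD] := goodF _ _ FU Ux; apply: nD.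
case: PW => [W_0|[sW W0W WD]].
  case: (maxW W0); last by right; split.
  by rewrite W_0; split=> [x //|/(_ _ W00)].
exists W; split=> // U sU WU UD; apply: contrapT => nUW.
by apply: (maxW U) => //; right; split=> // x /W0W/WU.
Qed.

End OneGroup.

Section Equivariant.
Variables (V W : zmodType) (actV : T -> V -> V) (actW : T -> W -> W).
Variable f : {additive V -> W}.
Hypothesis f_act : forall t x, f (actV t x) = actW t (f x).
Implicit Types (S U : set V).

Lemma op_subgroup_image S : op_subgroup actV S -> op_subgroup actW (f @` S).
Proof.
move=> [S0 SB SZ]; split=> [|_ _ [x Sx <-] [y Sy <-]|t _ [x Sx <-]].
- by exists 0; rewrite ?raddf0.
- by exists (x - y); [apply: SB | rewrite raddfB].
- by exists (actV t x); [apply: SZ|].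
Qed.

Lemma op_subgroup_preimage (U : set W) : op_subgroup actW U -> op_subgroup actV (f
  @^-1` U).
Proof.
move=> [U0 UB UZ]; split=> [|x y /= Ux Uy|t x /= Ux].
- by rewrite /= raddf0.
- by rewrite raddfB; apply: UB.
- by rewrite f_act; apply: UZ.
Qed.

Lemma length_le_image n S :
  op_subgroup actV S -> length_le actV n S -> length_le actW n (f @` S).
Proof.
elim: n S => [|n IHn] S sS lenS U sU US;
  have sP := op_subgroupI sS (op_subgroup_preimage sU).
  by move=> _ [x /(lenS _ sP (@subIsetl _ _ _)) [_ Ux] <-].
move=> nSU; apply: (@length_le_sub _ _ n (f @` (S `&` f @^-1` U))).
  by move=> y Uy; have [x Sx fx] := US _ Uy; exists x => //; split; rewrite //= fx.
apply: IHn => //; apply: (lenS _ sP (@subIsetl _ _ _)).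
by move=> SSU; apply: nSU => _ [x /SSU [_ Ux] <-].
Qed.

Hypothesis actWB : forall t x y, actW t (x - y) = actW t x - actW t y.

Lemma op_subgroup_kernel S :
  op_subgroup actV S -> op_subgroup actV (S `&` [set x | f x = 0]).
Proof.
move=> sS; apply: op_subgroupI => //.
have actW0 t : actW t 0 = 0 by rewrite -[X in actW t X](subrr 0) actWB subrr.
split=> [|x y /= fx fy|t x /= fx]; first exact: raddf0.
  by rewrite raddfB fx fy subrr.
by rewrite f_act fx.
Qed.

(** By the modular law a strict descent from [S] is strict on the kernel part or on the image, so it
    lowers [m] or [n]; hence the induction on the sum. *)
Lemma length_le_extension m n S : op_subgroup actV S ->
    length_le actV m (S `&` [set x | f x = 0]) -> length_le actW n (f @` S) ->
  length_le actV (m + n) S.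
Proof.
move: {2}(m + n)%N (erefl (m + n)%N) => N.
have modular U A : op_subgroup actV U -> op_subgroup actV A -> U `<=` A ->
    A `&` [set x | f x = 0] `<=` U `&` [set x | f x = 0] ->
    f @` A `<=` f @` U -> A `<=` U.
  move=> sU sA UA kAU fAU x Ax; have [y Uy fxy] := fAU _ (imageP f Ax).
  rewrite -[x](subrK y); apply: (op_subgroupD sU) => //.
  suff /kAU [] : (A `&` [set x | f x = 0]) (x - y) by [].
  split; last by rewrite /= raddfB fxy subrr.
  by have [_ AB _] := sA; apply: AB => //; apply: UA.
elim: N m n S => [|N IHN] m n S mn sS lenK lenI.
  move: mn lenK lenI => /eqP; rewrite addn_eq0 => /andP [/eqP -> /eqP ->] lenK lenI.
  move=> U sU US; apply: modular => //.
    by apply: lenK; [apply: op_subgroup_kernel | apply: setSI].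
  by apply: lenI; [apply: op_subgroup_image | apply: image_subset].
rewrite mn => U sU US nSU.
have sKU := op_subgroup_kernel sU; have sIU := op_subgroup_image sU.
have KUS := @setSI _ [set x | f x = 0] _ _ US;
  have IUS := @image_subset _ _ f _ _ US.
have [kSU|nk] := pselect (S `&` [set x | f x = 0] `<=` U `&` [set x | f x = 0]).
  have nI : ~ f @` S `<=` f @` U by move=> iSU; apply: nSU; apply: modular.
  case: n mn lenI => [|n] mn lenI; first by case: nI; apply: lenI.
  have -> : N = (m + n)%N by apply: succn_inj; rewrite -mn addnS.
  apply: IHN => //; first by apply: succn_inj; rewrite -mn addnS.
    exact: length_le_sub lenK.
  exact: lenI.
case: m mn lenK => [|m] mn lenK; first by case: nk; apply: lenK.
have -> : N = (m + n)%N by apply: succn_inj; rewrite -mn addSn.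
apply: IHN => //; first by apply: succn_inj; rewrite -mn addSn.
  exact: lenK.
exact: length_le_sub lenI.
Qed.

Lemma length_le_inj n S : op_subgroup actV S -> injective f ->
  length_le actW n (f @` S) -> length_le actV n S.
Proof.
move=> sS inj_f lenI; apply: (length_le_extension (m := 0)) => //.
move=> U [U0 _ _] _ x [_ /= fx0]; suff -> : x = 0 by [].
by apply: inj_f; rewrite raddf0.
Qed.

End Equivariant.

(** Restrict successively to the kernels of the [f i]; each step costs at most the length of [W]. *)
Lemma length_le_jointly_inj (V W : zmodType) (actV : T -> V -> V)
    (actW : T -> W -> W) (I : eqType) (f : I -> {additive V -> W}) n (s : seq I)
    (S : set V) :
    (forall t x y, actW t (x - y) = actW t x - actW t y) ->
    (forall i t x, f i (actV t x) = actW t (f i x)) ->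
    length_le actW n setT -> op_subgroup actV S ->
    (forall x, S x -> (forall i, i \in s -> f i x = 0) -> x = 0) ->
  length_le actV (size s * n) S.
Proof.
move=> actWB f_act lenW; elim: s S => [|i s IHs] S sS inj_S.
  by move=> U [U0 _ _] _ x Sx; rewrite (inj_S x).
rewrite /= mulSn addnC; apply: (length_le_extension (f_act i)) => //.
  apply: IHs => [|x [Sx /= fx] fsx]; first exact: (op_subgroup_kernel (f_act i)).
  by apply: inj_S => // j; rewrite inE => /orP [/eqP -> //|]; apply: fsx.
exact: length_le_sub lenW.
Qed.

End Length.

(** * A commutative artinian ring has finite length over itself *)

Section Hopkins.
Variable k : comPzRingType.
Implicit Types (I J U : set k).

Let act (t x : k) : k := t * x.
Let ideal := @op_subgroup k k act.
Let len := @length_le k k act.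

Let actB t x y : act t (x - y) = act t x - act t y.
Proof. exact: mulrBr. Qed.

Hypothesis artin_k : artinian_ring k.

Let min_ideal (Phi : set k -> Prop) :
    (forall I, Phi I -> ideal I) -> (exists I, Phi I) ->
  exists2 I, Phi I & forall J, Phi J -> J `<=` I -> I `<=` J.
Proof.
move=> idPhi [I0 PhiI0]; apply: contrapT => nomin.
have step (I : {I | Phi I}) : exists J : {I | Phi I},
  sval J `<=` sval I /\ ~ sval I `<=` sval J.
  apply: contrapT => no; apply: nomin; exists (sval I); first exact: svalP.
  move=> J PhiJ JI; apply: contrapT => nIJ; apply: no.
  by exists (exist _ J PhiJ).
have [next nextP] := boolp.choice step.
pose s n := iter n next (exist _ I0 PhiI0).
pose I n : {pred k^o} := [pred x | `[< sval (s n) x >]].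
have [|n x|N /(_ N.+1 (leqnSn _)) eqN] := @artin_k I.
- move=> n; have [I_0 IB IZ] := idPhi _ (svalP (s n)).
  split; first by apply/asboolP.
  move=> a x y /asboolP Ix /asboolP Iy; apply/asboolP.
  apply: op_subgroupD => //; first exact: idPhi (svalP (s n)).
  exact: IZ.
- by move=> /asboolP; have [sub _] := nextP (s n) => /sub ?; apply/asboolP.
have [_ []] := nextP (s N) => x sx.
suff : x \in I N.+1 by move=> /asboolP.
by rewrite eqN; apply/asboolP.
Qed.

(* An ideal I minimal among those of infinite length satisfies aI = 0 or aI = I for
   each a, and in the latter case a is invertible on I, so that I behaves like a
   vector space; an ideal maximal among those avoiding some x in I then meets I
   in a hyperplane, which has finite length. *)
Lemma hopkins : exists n, len n setT.
Proof.
apply: contrapT => nofin.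
pose bad I := ideal I /\ ~ exists n, len n I.
have [I [id_I bad_I] min_I] : exists2 I, bad I & forall J,
  bad J -> J `<=` I -> I `<=` J.
  by apply: min_ideal => [I []//|]; exists setT.
have finI J : ideal J -> J `<=` I -> ~ I `<=` J -> exists n, len n J.
  by move=> id_J JI nIJ; apply: contrapT => nfin; apply: nIJ; apply: min_I.
have [I0 IB IZ] := id_I.
have mulI a : (forall x, I x -> a * x = 0) \/ (forall x, I x -> exists2 y,
  I y & x = a * y).
  pose f : {additive k -> k} := a \*o idfun.
  have f_act t x : f (act t x) = act t (f x) by rewrite /f /act /= mulrCA.
  have idK := op_subgroup_kernel f_act actB id_I.
  have idJ := op_subgroup_image f_act id_I.
  have [IJ|nIJ] := pselect (I `<=` f @` I).
    by right=> x /IJ [y Iy <-]; exists y.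
  have [IK|nIK] := pselect (I `<=` I `&` [set x | f x = 0]).
    by left=> x /IK [].
  (* If kernel and image of multiplication by [a] on [I] are both proper, both have finite length by
     minimality, and so would [I]. *)
  have [m lenK] := finI _ idK (@subIsetl _ _ _) nIK.
  have [|n lenJ] := finI _ idJ _ nIJ; first by move=> _ [x Ix <-]; apply: IZ.
  by case: bad_I; exists (m + n)%N; apply: (length_le_extension f_act).
have invI a : ~ (forall x, I x -> a * x = 0) -> exists b, forall x,
  I x -> b * (a * x) = x.
  move=> na; have aI x : I x -> exists2 y, I y & x = a * y.
    by case: (mulI a) => [/na //|]; apply.
  have aiI i x : I x -> exists2 y, I y & x = a ^+ i * y.
    elim: i x => [|i IHi] x Ix; first by exists x; rewrite // expr0 mul1r.
    have [y /aI [z Iz ->] ->] := IHi x Ix; exists z => //.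
    by rewrite exprSr mulrA.
  (* The powers of [a] generate a descending chain of ideals; where it stops,
     [a ^+ i = a ^+ i.+1 * b]. As every element of [I] is a multiple of [a ^+ i], this [b] inverts
     [a] on [I]. *)
  pose J i : set k := [set x | exists c, x = a ^+ i * c].
  have [||_ [i ->] minJ] := @min_ideal (fun U => exists i, U = J i).
  - move=> _ [i ->]; split=> [|_ _ [c ->] [d ->]|t _ [c ->]].
    + by exists 0; rewrite mulr0.
    + by exists (c - d); rewrite mulrBr.
    + by exists (t * c); rewrite /act mulrCA.
  - by exists (J 0%N), 0%N.
  have [b eb] : J i.+1 (a ^+ i).
    apply: (minJ (J i.+1)) => [|_ [c ->]|]; first by exists i.+1.
      by exists (a * c); rewrite exprSr mulrA.
    by exists 1; rewrite mulr1.
  exists b => x /(aiI i) [y _ ->].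
  by rewrite [a * _]mulrA -exprS mulrCA mulrA -eb.
have [I_0|] := pselect (forall x, I x -> x = 0).
  by case: bad_I; exists 0%N => U [U0 _ _] _ x /I_0 ->.
move=> /existsNP [x /not_implyP [Ix nx0]].
have [|y ->|W [id_W _ WD maxW]] := @op_subgroup_zorn k k act [set 0] [set x].
- split=> // [_ _ -> ->|t _ ->] /=; first by rewrite subrr.
  by rewrite /act mulr0.
- by move=> /esym.
have nWx : ~ W x by move=> /WD; apply.
(* By maximality of [W], the ideal generated by [W] and [y] contains [x]. The coefficient [c] of [y]
   does not kill [I], as [x] would then lie in [W], so it is invertible on [I]. *)
have genI y : I y -> ~ W y ->
    exists w c b, [/\ W w, x - w = c * y, I w & forall z, I z -> b * (c * z) = z].
  move=> Iy nWy; pose J : set k := [set z | exists c, z = c * y].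
  have id_J : ideal J.
    split=> [|_ _ [c ->] [d ->]|t _ [c ->]].
    - by exists 0; rewrite mul0r.
    - by exists (c - d); rewrite mulrBl.
    - by exists (t * c); rewrite /act mulrA.
  have [w Ww [c xw]] : exists2 w, W w & J (x - w).
    apply: contrapT => nWJ; apply: nWy; have [W0 _ _] := id_W.
    apply: (maxW _ (op_subgroup_sum actB id_W id_J)) => [v Wv|v [w Ww Jvw] /= vx|].
    - by exists v; rewrite // subrr; case: id_J.
    - by apply: nWJ; exists w; rewrite // -vx.
    - by exists 0; rewrite // subr0; exists 1; rewrite mul1r.
  have [|b bP] := invI c.
    move=> /(_ y Iy) cy0; apply: nWx; suff -> : x = w by [].
    by apply/eqP; rewrite -subr_eq0 xw cy0.
  exists w, c, b; split=> //; rewrite -[w](subKr x); apply: IB => //.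
  by rewrite xw; apply: IZ.
pose WI := W `&` I; have id_WI : ideal WI by apply: op_subgroupI.
have [||n lenWI] := finI WI id_WI; first exact: subIsetr.
  by move=> /(_ x Ix) [].
case: bad_I; exists n.+1; apply: (length_le_cover actB id_I id_WI) => //.
  exact: subIsetr.
move=> U id_U WIU UI; have [UW|nUW] := pselect (U `<=` W).
  by left=> z Uz; split; [apply: UW | apply: UI].
have [y /not_implyP [Uy nWy]] : exists y, ~ (U y -> W y) by apply/existsNP.
have [w [c [b [Ww xw Iw _]]]] := genI y (UI _ Uy) nWy.
have Ux : U x.
  rewrite -[x](subrK w) xw; apply: (op_subgroupD id_U); last exact: WIU.
  by have [_ _ UZ] := id_U; apply: UZ.
(* [c' * z = x - w'] already lies in [U], and [b'] recovers [z] from it. *)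
right=> z Iz; have [Wz|nWz] := pselect (W z); first exact: WIU.
have [w' [c' [b' [Ww' xw' Iw' bc']]]] := genI z Iz nWz.
have [_ UB UZ] := id_U.
by rewrite -(bc' z Iz) -xw'; apply: UZ; apply: UB => //; apply: WIU.
Qed.

End Hopkins.

(** * Length of modules under a family of ring elements *)

Section CentralAction.
Variables (R : pzRingType) (T : Type) (z : T -> R).
Implicit Types A B C J K M P Q X Y Z : lmodType R.

Definition zact M (t : T) (x : M) : M := z t *: x.

Lemma zactB M t (x y : M) : zact t (x - y) = zact t x - zact t y.
Proof. exact: scalerBr. Qed.

Lemma zact_linear A B (f : {linear A -> B}) t x : f (zact t x) = zact t (f x).
Proof. exact: linearZ. Qed.

Lemma op_subgroupT M : op_subgroup (@zact M) setT.
Proof. by []. Qed.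

Lemma submod_op M (S : set M) : is_submod S -> op_subgroup (@zact M) S.
Proof.
move=> sS; split=> [|x y|t x]; first by case: sS.
  exact: submodB.
exact: submodZ.
Qed.

(** Length counts subgroups stable under the scalars [z t] only; for an artin algebra it is length
    over the base ring. Submodules are among these subgroups. *)
Definition zlen_le n M := length_le (@zact M) n setT.

Lemma zlen_le_surj A B (f : {linear A -> B}) n :
  surjective f -> zlen_le n A -> zlen_le n B.
Proof.
move=> sf /(length_le_image (f := f) (zact_linear f) (@op_subgroupT A)).
by apply: length_le_sub => y _; have [x ->] := sf y; exists x.
Qed.

Lemma zlen_le_inj A B (f : {linear A -> B}) n :
  injective f -> zlen_le n B -> zlen_le n A.
Proof.
move=> inj_f lenB; apply: (length_le_inj (zact_linear f) (@zactB B)) => //.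
exact: length_le_sub lenB.
Qed.

Definition finite_length M := exists n, zlen_le n M.

Hypothesis finR : finite_length R^o.

Lemma free_mod_finite_length m : finite_length (free_mod R m).
Proof.
have [n lenR] := finR; exists (size (enum 'I_m) * n)%N.
have lin_c i : linear (fun x : free_mod R m => x i : R^o).
  by move=> a x y; rewrite !ffunE.
apply: (length_le_jointly_inj (f :=
  fun i => mk_linear (lin_c i)) (@zactB _) _ lenR) => //.
  by move=> i t x; apply: zact_linear.
by move=> x _ fx; apply/ffunP => i; rewrite ffunE; apply: (fx i); rewrite mem_enum.
Qed.

Lemma fin_gen_finite_length M : fin_gen M -> finite_length M.
Proof.
move=> /free_cover [m [p sp]]; have [n lenR] := free_mod_finite_length m.
by exists n; apply: zlen_le_surj sp lenR.
Qed.

(** A maximal finitely generated submodule is everything, since adjoining any [x] keeps it finitely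
    generated. *)
Lemma finite_length_fin_gen M : finite_length M -> fin_gen M.
Proof.
move=> [n lenM].
pose Phi (U : set M) := exists A (f : {linear A -> M}),
  fin_gen A /\ forall x, U x <-> exists y, x = f y.
have imU A (f : {linear A -> M}) : fin_gen A -> Phi [set x | exists y, x = f y].
  by move=> fA; exists A, f.
have [U [A [f [fA UP]]]||U [A [f [fA UP]]] maxU] := length_le_max (Phi := Phi) lenM.
- split=> //; have -> : U = [set x | exists y, x = f y] by apply/predeqP.
  by apply: submod_op; apply: im_submod.
- exists [set x | exists y, x = (\0 : {linear free_mod R 0 -> M}) y]; apply: imU.
  exact: free_mod_fin_gen.
apply: (@fin_gen_surj _ _ _ f) => // x; apply/UP.
have lin_g : linear (fun y : (A * R^o)%type => f y.1 + (y.2 : R) *: x).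
  by move=> a y y'; rewrite /= linearP scalerDl -scalerA scalerDr addrACA.
have fAR : fin_gen (A * R^o)%type.
  by apply: fin_gen_prod => //; case: (regular_fg_projective R).
apply: (maxU _ (imU _ (mk_linear lin_g) fAR)) => [y /UP [a ->]|].
  by exists (a, 0); rewrite /= scale0r addr0.
by exists (0, 1); rewrite /= linear0 scale1r add0r.
Qed.

Lemma central_noetherian : noetherian R.
Proof.
move=> A B f inj_f /fin_gen_finite_length [n lenB]; apply: finite_length_fin_gen.
by exists n; apply: zlen_le_inj inj_f lenB.
Qed.

End CentralAction.

(** * Artin algebras have finite length over their base ring *)

Section ArtinAlgebra.
Variables (k : comPzRingType) (L : algType k).
Hypothesis artinL : artin_algebra L.

Definition central_scalar (t : k) : L := t%:A.

Lemma central_scalarC t x : central_scalar t * x = x * central_scalar t.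
Proof. by rewrite mulr_algl mulr_algr. Qed.

(** [L] is a quotient of a finite power of [k], which has finite length by [hopkins]. *)
Lemma artin_algebra_length : exists n,
  length_le (fun t x => central_scalar t * x) n [set: L].
Proof.
have [/hopkins [n lenk] /free_cover [m [p sp]]] := artinL.
have [|N lenF] := @free_mod_finite_length k k id _ m.
  by exists n; apply: lenk.
exists N.
have := length_le_image (f := p) (actW := fun t x => central_scalar t * x) _ _ lenF.
move=> H; apply: length_le_sub (H _ _) => //.
  by move=> y _; have [x ->] := sp y; exists x.
by move=> t x; rewrite /central_scalar mulr_algl; apply: (linearZ_LR p t x).
Qed.

End ArtinAlgebra.

(** * Injective hulls and approximations *)

Lemma op_subgroup_submod (R : pzRingType) (M : lmodType R) (S : set M) :
  op_subgroup (fun (r : R) x => r *: x) S <-> is_submod S.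
Proof.
split=> [sS|sS].
  by split=> [|a x y Sx Sy]; [case: sS | apply: (op_subgroupD sS) => //;
    case: sS => _ _; apply].
split=> [|x y|t x]; first by case: sS.
  exact: submodB.
exact: submodZ.
Qed.

Section InjectiveHull.
Variables (R : pzRingType) (T : Type) (z : T -> R).
Implicit Types A B C E J K M P Q X Y : lmodType R.
Hypothesis zC : forall t r, z t * r = r * z t.
Hypothesis finR : finite_length z R^o.

Definition mk_additive (V W : zmodType) (f : V -> W) (fB : zmod_morphism f) :
  {additive V -> W} := HB.pack f (GRing.isZmodMorphism.Build V W f fB).

Lemma scale_zact M r t (x : M) : r *: zact z t x = zact z t (r *: x).
Proof. by rewrite /zact !scalerA zC. Qed.

Lemma maximal_submod M (S : set M) n : length_le (@zact R T z M) n S ->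
    is_submod S -> (exists2 x, S x & x <> 0) ->
  exists W : set M, [/\ is_submod W, W `<=` S, ~ S `<=` W &
    forall U, is_submod U -> W `<=` U -> U `<=` S -> ~ U `<=` W -> S `<=` U].
Proof.
move=> lenS sS [x Sx nx0].
pose Phi (U : set M) := [/\ is_submod U, U `<=` S & ~ S `<=` U].
have [||W [sW WS nSW] maxW] := length_le_max (Phi := Phi) lenS.
- by move=> U [sU US _]; split=> //; apply: submod_op.
- exists [set 0]; split=> [|_ ->|/(_ x Sx)] //; last by case: sS.
  by split=> // a _ _ -> ->; rewrite scaler0 addr0.
exists W; split=> // U sU WU US nUW; apply: contrapT => nSU.
by apply: nUW; apply: maxW.
Qed.

Definition annihilated E (I : set R^o) : set E :=
  [set e | forall r, I r -> (r : R) *: e = 0].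

Lemma annihilated_op E I : op_subgroup (@zact R T z E) (annihilated I).
Proof.
split=> [r _|x y Ix Iy r Ir|t x Ix r Ir]; first by rewrite scaler0.
  by rewrite scalerBr Ix ?Iy ?subrr.
by rewrite scale_zact Ix // /zact scaler0.
Qed.

Definition essential M E (i : {linear M -> E}) : Prop :=
  forall x, x <> 0 -> exists r m, r *: x = i m /\ i m <> 0.

(* For [W] maximal in [I] and [x] in [I] outside [W], multiplication by [x] maps
   the elements killed by [W] into simple submodules, hence into [M]. *)
Lemma essential_length M E (i : {linear M -> E}) m n c (I : set R^o) :
    essential i -> zlen_le z m M -> is_submod I ->
    length_le (@zact R T z R^o) n I ->
    length_le (@zact R T z E) c (annihilated I) ->
  zlen_le z (c + n * m) E.
Proof.
move=> ess lenM; elim: n c I => [|n IHn] c I sI lenI lenann.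
  rewrite mul0n addn0; apply: length_le_sub lenann => e _ r Ir.
  suff -> : r = 0 by rewrite scale0r.
  apply: (lenI [set 0] _ _ r Ir) => [|_ ->]; last by case: sI.
  by apply: submod_op; split=> // a _ _ -> ->; rewrite scaler0 addr0.
have [I0|] := pselect (exists2 x, I x & x <> 0); last first.
  move=> nI; apply: (@length_le_leq _ _ _ c); first exact: leq_addr.
  apply: length_le_sub lenann => e _ r Ir.
  have [->|nr] := pselect (r = 0); first by rewrite scale0r.
  by case: nI; exists r.
have [W [sW WI nIW maxW]] := maximal_submod lenI sI I0.
have [x /not_implyP [Ix nWx]] : exists x, ~ (I x -> W x) by apply/existsNP.
have maxWx U : is_submod U -> W `<=` U -> U `<=` I -> forall y, U y -> ~ W y -> U x.
  by move=> sU WU UI y Uy nWy; apply: maxW Ix => //; move=> /(_ _ Uy).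
have lenW : length_le (@zact R T z R^o) n W by apply: lenI => //; apply: submod_op.
have xB : zmod_morphism (fun e : E => (x : R) *: e) by move=> e e';
  rewrite scalerBr.
suff lenannW : length_le (@zact R T z E) (c + m) (annihilated W).
  by have := IHn _ W sW lenW lenannW; rewrite -addnA mulSn.
apply: (length_le_extension (f := mk_additive xB) (actW := @zact R T z E)) => /=.
- by move=> t e; rewrite scale_zact.
- exact: zactB.
- exact: annihilated_op.
- apply: length_le_sub lenann => e [We /= xe] r Ir.
  (* The annihilator of [e] in [I] contains [W] and also [x], so by maximality of [W] it is all of
     [I]. *)
  pose U : set R^o := [set r | I r /\ (r : R) *: e = 0].
  have sU : is_submod U.
    split=> [|a r' s [Ir' re] [Is se]]; first by split;
      [case: sI | rewrite scale0r].
    split; first by case: sI => _; apply.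
    by rewrite scalerDl -scalerA re se scaler0 addr0.
  have WU : W `<=` U by move=> w Ww; split; [apply: WI | apply: We].
  suff IU : I `<=` U by case: (IU _ Ir).
  by apply: maxW => // [w []//|/(_ x)]; move=> UW; apply: nWx; apply: UW.
apply: (@length_le_sub _ _ _ _ (i @` setT)); last first.
  by apply: (length_le_image (zact_linear z i)) => //; apply: op_subgroupT.
move=> _ [e We <-] /=; have [->|] := pselect ((x : R) *: e = 0).
  by exists 0; rewrite ?linear0.
move=> /ess [r [y [rxe iy0]]].
(* [U] collects the elements of [I] moving [e] into [M]. It contains [W] and also [r * x], which is
   outside [W] because [r * x] does not kill [e]; maximality then puts [x] in [U]. *)
pose U : set R^o := [set s | I s /\ exists v, (s : R) *: e = i v].
have sU : is_submod U.
  split=> [|a s s' [Is [v sv]] [Is' [v' sv']]].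
    by split; [case: sI | exists 0; rewrite scale0r linear0].
  split; first by case: sI => _; apply.
  by exists (a *: v + v'); rewrite scalerDl -scalerA sv sv' linearP.
have WU : W `<=` U.
  by move=> w Ww; split; [apply: WI | exists 0; rewrite We ?linear0].
suff [_ [v ->]] : U x by exists v.
apply: (maxWx U sU WU _ (r * x)) => [s []//||].
  by split; [apply: submodZ | exists y; rewrite -rxe scalerA].
by move=> Wrx; apply: iy0; rewrite -rxe scalerA We.
Qed.

(** Start the filtration at the whole ring, whose annihilated part is zero because it contains 1. *)
Lemma essential_bound M : fin_gen M -> exists N, forall E (i : {linear M -> E}),
  essential i -> zlen_le z N E.
Proof.
move=> /(fin_gen_finite_length finR) [m lenM]; have [n lenR] := finR.
exists (n * m)%N => E i ess;
  apply: (essential_length (c := 0) ess lenM _ lenR) => //.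
by move=> U [U0 _ _] _ e /(_ 1 I); rewrite scale1r => ->.
Qed.

Lemma essential_comp M E Q (i : {linear M -> E}) (j : {linear E -> Q}) :
  injective j -> essential i -> essential j -> essential (j \o i).
Proof.
move=> inj_j ess_i ess_j q /ess_j [r [e [rq je]]].
have [|s [m [se im]]] := ess_i e; first by move=> e0; apply: je; rewrite e0 linear0.
exists (s * r), m; split; first by rewrite -scalerA rq -linearZ se.
by move=> /= jim; apply: im; apply: inj_j; rewrite jim linear0.
Qed.

(** Take an essential extension of greatest length: a proper essential extension of it would be
    longer. *)
Lemma maximal_essential_exists M : fin_gen M ->
  exists E (i : {linear M -> E}), [/\ injective i, fin_gen E &
    forall Q (j : {linear E -> Q}), injective j -> essential j -> surjective j].
Proof.
move=> fM; have [N leN] := essential_bound fM.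
pose P n := `[< exists E (i : {linear M -> E}),
  [/\ injective i, essential i & n = 0%N \/ ~ zlen_le z n.-1 E] >].
have exP : exists n, P n.
  exists 0%N; apply/asboolP; exists M, idfun; split=> //; last by left.
  by move=> x nx; exists 1, x; rewrite scale1r.
have leP n : P n -> (n <= N)%N.
  move=> /asboolP [E [i [_ /leN lenE [-> //|nlen]]]].
  case: n nlen => // n nlen; rewrite ltnNge; apply/negP => Nn; apply: nlen.
  exact: length_le_leq lenE.
case: (ex_maxnP exP leP) => n /asboolP [E [i [inj_i ess_i nlen]]] max.
exists E, i; split=> //.
  by apply: (finite_length_fin_gen (z := z)); exists N; apply: leN ess_i.
move=> Q j inj_j ess_j y; apply: contrapT => ny.
suff : P n.+1 by move=> /max; rewrite ltnn.
apply/asboolP; exists Q, (j \o i); split.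
- exact: inj_comp.
- exact: essential_comp.
right=> /= lenQ.
have sj : op_subgroup (@zact R T z Q) (j @` setT).
  by apply: (op_subgroup_image (zact_linear z j)); apply: op_subgroupT.
have nj : ~ setT `<=` j @` setT by move=> /(_ y I) [x _ yx]; apply: ny; exists x.
case: n nlen lenQ {max} => [_|n [//|nlen]] lenQ; first by apply: nj; apply: lenQ.
apply: nlen => /=; apply: (length_le_inj (zact_linear z j)) => //.
  exact: zactB.
by apply: lenQ.
Qed.

(** Glue [E] and [B] along [A], then divide further by a maximal submodule [N] still meeting [E] in
    0. Then [E] embeds essentially in the quotient, hence fills it, and the image of [B] there is
    read back in [E]. *)
Lemma maximal_essential_injective E :
    (forall Q (j : {linear E -> Q}), injective j -> essential j -> surjective j) ->
  injective_mod E.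
Proof.
move=> maxE A B a g inj_a; pose V : lmodType R := (E * B)%type.
have lin_w : linear (fun x => (g x, - a x) : V).
  by move=> r x y; rewrite [RHS]surjective_pairing /= !linearP scalerN -opprD.
pose D : set V := [set v | v.2 = 0 /\ v.1 <> 0].
have sW0 := im_submod (mk_linear lin_w).
have [v [x ->] [/= ax ngx]|N [sN W0N ND maxN]] :=
  @op_subgroup_zorn R V (fun (r : R) x => r *: x) _ D
  ((op_subgroup_submod _).2 sW0).
  by apply: ngx; rewrite (inj_a x 0) ?linear0 //; apply: oppr_inj; rewrite oppr0.
have {sN} sN := (op_subgroup_submod _).1 sN.
have [Q [p [sp pN]]] := quotient_exists sN.
have lin_1 : linear (fun e => (e, 0) : V).
  by move=> r x y; rewrite [RHS]surjective_pairing /= scaler0 addr0.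
have lin_2 : linear (fun b => (0, b) : V).
  by move=> r x y; rewrite [RHS]surjective_pairing /= scaler0 addr0.
pose j : {linear E -> Q} := p \o mk_linear lin_1.
have inj_j : injective j.
  apply: linear_inj => e /pN Ne; apply: contrapT => ne.
  by apply: (ND _ Ne).
have ess_j : essential j.
  move=> q nq; have [v pv] := sp q.
  (* [U] is [N] enlarged by [v]. Since [v] is not in [N], maximality forces [U] to contain a nonzero
     element of [E]. *)
  pose U : set V := [set u | exists r, N (u - r *: v)].
  have sU : is_submod U.
    split=> [|r u u' [s Ns] [s' Ns']]; first by exists 0; rewrite scale0r subr0;
      case: sN.
    exists (r * s + s'); rewrite scalerDl -scalerA opprD addrACA -scalerBr.
    by apply: submodD => //; apply: submodZ.
  have [u [[r Nur] [u2 u1]]] : exists u, U u /\ D u.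
    apply: contrapT => no; apply: nq; rewrite pv; apply/pN.
    apply: (maxN U ((op_subgroup_submod _).2 sU)) => [w Nw|w Uw Dw|].
    - by exists 0; rewrite scale0r subr0.
    - by apply: no; exists w.
    - by exists 1; rewrite scale1r subrr; case: sN.
  have eu : u = (u.1, 0) by rewrite [LHS]surjective_pairing u2.
  exists r, u.1; rewrite /= -eu; split.
    by apply/esym/eqP; rewrite -subr_eq0 pv -linearZ -linearB; apply/eqP/pN.
  by move=> /pN; rewrite eu => /ND; apply.
have sj := maxE Q j inj_j ess_j.
have [b|r b e b' e' h h'|e h|f fP] :=
    @linear_of_rel R B E (fun b e => p (0, b) = j e).
- by have [e ->] := sj (p (0, b)); exists e.
- have -> : (0, r *: b + b') = r *: (0, b) + (0, b') :> V := lin_2 r b b'.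
  by rewrite [LHS]linearP [RHS]linearP h h'.
- by apply: inj_j; rewrite -h; transitivity (0 : Q);
    [exact: linear0 | exact/esym/linear0].
exists f => x; apply: inj_j; rewrite -fP; apply/eqP; rewrite -subr_eq0.
rewrite -[j (g x)]/(p (g x, 0)) -linearB; apply/eqP/pN; apply: W0N; exists x => /=.
by rewrite [LHS]surjective_pairing /= subr0 sub0r.
Qed.

Lemma central_enough_fg_injectives : enough_fg_injectives R.
Proof.
move=> X /maximal_essential_exists [E [i [inj_i fE maxE]]].
by exists E, i; split=> //; split=> //; apply: maximal_essential_injective.
Qed.

(* If x generates a simple module, W is maximal in I, and W kills x but I does
   not, then Rx is isomorphic to I/W, a submodule of R/W. *)
Lemma detects_simples n (I : set R^o) :
    is_submod I -> length_le (@zact R T z R^o) n I ->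
  exists E, fg_injective E /\ forall X (x : X),
    (forall r, r *: x <> 0 -> exists b, b *: (r *: x) = x) ->
    (exists a : R, I a /\ a *: x <> 0) ->
  exists e : E, e <> 0 /\ forall r, r *: x = 0 -> r *: e = 0.
Proof.
elim: n I => [|n IHn] I sI lenI.
all: have [I0|nI] := pselect (exists2 x, I x & x <> 0); last first.
all: try by exists (free_mod R 0); split; [split; [exact: free_mod_fin_gen |
    by move=> A B i g _; exists \0 => x; apply/ffunP; case] |
  by move=> X x _ [a [Ia ax]]; case: nI; exists a => // a0;
     apply: ax; rewrite a0 scale0r].
  case: I0 => x Ix nx0; case: nx0; apply: (lenI [set 0]) Ix => [|_ ->];
    last by case: sI.
  by apply: submod_op; split=> // a _ _ -> ->; rewrite scaler0 addr0.
have [W [sW WI nIW maxW]] := maximal_submod lenI sI I0.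
have lenW : length_le (@zact R T z R^o) n W by apply: lenI => //; apply: submod_op.
have [E0 [injE0 E0P]] := IHn W sW lenW.
have [Q [p [sp pW]]] := quotient_exists sW.
have fQ : fin_gen Q.
  by apply: (fin_gen_surj sp); apply: (finite_length_fin_gen finR).
have [E1 [i [injE1 inj_i]]] := central_enough_fg_injectives fQ.
exists (E0 * E1)%type; split; first exact: fg_injective_prod.
move=> X x simple_x [a [Ia ax]].
have [Wx|nWx] := pselect (exists a : R, W a /\ a *: x <> 0).
  have [e [ne eP]] := E0P X x simple_x Wx.
  exists (e, 0); split=> [[/ne]//|r /eP re].
  by rewrite [LHS]surjective_pairing /= re scaler0.
have killW w : W w -> (w : R) *: x = 0.
  by move=> Ww; apply: contrapT => wx; apply: nWx; exists w.
have [b bax] := simple_x a ax.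
have Iann r : I r -> (r : R) *: x = 0 -> W r.
  move=> Ir rx; apply: contrapT => nWr; apply: ax.
  pose U : set R^o := [set r | I r /\ (r : R) *: x = 0].
  suff IU : I `<=` U by case: (IU _ Ia).
  apply: maxW => [|w Ww|w []//|/(_ r)]; last by move=> h; apply: nWr; apply: h.
    split=> [|c u v [Iu ux] [Iv vx]]; first by split; [case: sI | rewrite scale0r].
    split; first by case: sI => _; apply.
    by rewrite scalerDl -scalerA ux vx scaler0 addr0.
  by split; [apply: WI | apply: killW].
(* [b * a] lies in [I] and fixes [x], so its class modulo [W] is nonzero and is killed by everything
   that kills [x]. *)
exists (0, i (p (b * a : R))); split=> [[/eqP]|r rx].
  rewrite -[X in _ == X](linear0 i) => /eqP /inj_i /pW /killW.
  by rewrite -scalerA bax => x0; apply: ax; rewrite x0 scaler0.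
suff pr0 : p (r * (b * a) : R) = 0.
  rewrite [LHS]surjective_pairing /= scaler0; congr (_, _).
  by rewrite -!linearZ; apply: etrans (congr1 i pr0) (linear0 i).
apply/pW; apply: Iann; last by rewrite -!scalerA bax.
by apply: (submodZ (r : R) sI); apply: (submodZ (b : R) sI).
Qed.

(** Apply [detects_simples] to the whole ring. Modulo a submodule [N] maximal among those avoiding
    [x], the image of [x] generates a simple module; map it nontrivially to [E] and extend by
    injectivity. *)
Lemma cogenerator_exists : exists E, fg_injective E /\
  forall X, fin_gen X -> forall x : X, x <> 0 ->
  exists f : {linear X -> E}, f x <> 0.
Proof.
have [n lenR] := finR.
have [//|E [injE EP]] := @detects_simples n setT _ lenR.
exists E; split=> // X fX x nx; have [m lenX] := fin_gen_finite_length finR fX.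
pose Phi (U : set X) := is_submod U /\ ~ U x.
have [||N [sN Nx] maxN] := length_le_max (Phi := Phi) lenX.
- by move=> U [sU _]; split=> //; apply: submod_op.
- exists [set 0]; split=> //.
  by split=> // a _ _ -> ->; rewrite scaler0 addr0.
have [Q [p [sp pN]]] := quotient_exists sN.
have simple_px r : r *: p x <> 0 -> exists b, b *: (r *: p x) = p x.
  rewrite -linearZ => nrx; have nNrx : ~ N (r *: x) by move=> /pN.
  pose U : set X := [set u | exists b, N (u - b *: (r *: x))].
  have sU : is_submod U.
    split=> [|c u u' [s Ns] [s' Ns']]; first by exists 0; rewrite scale0r subr0;
      case: sN.
    exists (c * s + s'); rewrite scalerDl -[(c * s) *: _]scalerA opprD addrACA
      -scalerBr.
    by apply: submodD => //; apply: submodZ.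
  have [b Nb] : U x.
    apply: contrapT => nUx; apply: nNrx; apply: (maxN U) => [//|u Nu|].
      by exists 0; rewrite scale0r subr0.
    by exists 1; rewrite scale1r subrr; case: sN.
  exists b; apply/esym/eqP; rewrite -subr_eq0 -linearZ -linearB.
  by apply/eqP/pN.
have npx : p x <> 0 by move=> /pN.
have [|e [ne eP]] := EP Q (p x) simple_px.
  by exists 1; rewrite scale1r.
have sS : is_submod (fun q => exists r, q = r *: p x).
  split=> [|a _ _ [r ->] [s ->]]; first by exists 0; rewrite scale0r.
  by exists (a * r + s); rewrite scalerDl scalerA.
have [K [i [inj_i iP]]] := submodule_exists sS.
have [y|a y u y' u' [r [yr ->]] [r' [yr' ->]]|u [r [yr ->]]|h hP] :=
    @linear_of_rel R K E (fun y u => exists r, i y = r *: p x /\ u = r *: e).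
- have /iP [r ir] : exists y', i y = i y' by exists y.
  by exists (r *: e), r.
- exists (a * r + r'); rewrite linearP yr yr' !scalerDl !scalerA //.
- by apply: eP; rewrite -yr linear0.
have [k kP] := injE.2 _ _ i h inj_i.
have [y iy] : exists y, p x = i y by apply/iP; exists 1; rewrite scale1r.
exists (k \o p); rewrite /= iy -kP.
have [r [yr ->]] := hP y; suff -> : r *: e = e by [].
apply/eqP; rewrite -subr_eq0 -[X in _ - X]scale1r -scalerBl; apply/eqP/eP.
by rewrite scalerBl scale1r -yr iy subrr.
Qed.

Lemma hom_family_max K (V : lmodType R) (Phi : set (set {linear K -> V})) :
    fin_gen K -> fin_gen V ->
    (forall H, Phi H -> [/\ H \0, forall f g, H f -> H g -> H (f \- g) &
       forall t f, H f -> exists2 g, H g & forall x, g x = z t *: f x]) ->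
    (exists H, Phi H) ->
  exists2 H, Phi H & forall H', Phi H' -> H `<=` H' ->
    forall f, H' f -> exists2 g, H g & f =1 g.
Proof.
move=> [m [e eP]] fV PhiP exPhi.
have [n lenV] := fin_gen_finite_length finR fV.
pose W : lmodType R := {ffun 'I_m -> V}.
have lenW : zlen_le z (size (enum 'I_m) * n) W.
  have lin_c i : linear (fun x : W => x i) by move=> a x y; rewrite !ffunE.
  apply: (length_le_jointly_inj (f :=
    fun i => mk_linear (lin_c i)) (@zactB _ _ _ _) _ lenV) => //.
    by move=> i t x; apply: zact_linear.
  by move=> x _ fx; apply/ffunP => i; rewrite ffunE; apply: (fx i);
    rewrite mem_enum.
pose val_on (H : set {linear K -> V}) : set W :=
  [set v | exists2 f, H f & v = [ffun i => f (e i)]].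
pose Psi (U : set W) := exists2 H, Phi H & U = val_on H.
have [||_ [H PhiH ->] maxH] := length_le_max (Phi := Psi) lenW.
- move=> _ [H /PhiP [H0 HB HZ] ->]; split=> //; split.
  + by exists \0 => //; apply/ffunP => i; rewrite !ffunE.
  + move=> _ _ [f Hf ->] [g Hg ->]; exists (f \- g); first exact: HB.
    by apply/ffunP => i; rewrite !ffunE.
  + move=> t _ [f Hf ->]; have [g Hg gf] := HZ t f Hf; exists g => //.
    by apply/ffunP => i; rewrite !ffunE gf.
- by have [H PhiH] := exPhi; exists (val_on H), H.
exists H => // H' PhiH' HH' f H'f.
have [|||g Hg /ffunP fg] := maxH (val_on H') _ _ [ffun i => f (e i)].
- by exists H'.
- by move=> _ [g Hg ->]; exists g => //; apply: HH'.
- by exists f.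
exists g => // x; have [c ->] := eP x; rewrite !linear_sum.
by apply: eq_bigr => i _; rewrite !linearZ; have := fg i; rewrite !ffunE => ->.
Qed.

Lemma central_scale_linear A B t (f : {linear A -> B}) : linear (fun x => z t *: f
  x).
Proof. by move=> a x y; rewrite linearP scalerDr !scalerA zC. Qed.

(** Choose [phi] so that the set of functionals factoring through it is maximal. Adding a functional
    [h] as a further coordinate of [phi] would enlarge this set, so all functionals factor; retracts
    of free modules follow. *)
Lemma left_projective_approx K : fin_gen K ->
  exists P (phi : {linear K -> P}), fg_projective P /\
  forall Q, fg_projective Q -> forall h : {linear K -> Q},
    exists h' : {linear P -> Q}, forall x, h x = h' (phi x).
Proof.
move=> fK.
pose thru P (phi : {linear K -> P}) : set {linear K -> R^o} :=
  [set h | exists h' : {linear P -> R^o}, forall x, h x = h' (phi x)].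
pose Phi H := exists P (phi : {linear K -> P}), fg_projective P /\ H = thru P phi.
have pR := regular_fg_projective R.
have [||_ [P [phi [fgP ->]]] maxP] := @hom_family_max K R^o Phi fK pR.1.
- move=> _ [P [phi [_ ->]]]; split=> [|f g [f' fP] [g' gP]|t f [f' fP]].
  + by exists \0.
  + by exists (f' \- g') => x; rewrite /= fP gP.
  + exists (mk_linear (central_scale_linear t f)) => //.
    by exists (mk_linear (central_scale_linear t f')) => x; rewrite /= fP.
- by exists (thru R^o \0), R^o, \0.
exists P, phi; split=> //.
have thruR (h : {linear K -> R^o}) : exists h' : {linear P -> R^o}, forall x,
  h x = h' (phi x).
  have lin_psi : linear (fun x => (phi x, h x) : (P * R^o)%type).
    by move=> a x y; rewrite !linearP.
  have [|||g [h' h'P] hg] := maxP (thru _ (mk_linear lin_psi)) _ _ h.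
  + by exists (P * R^o)%type, (mk_linear lin_psi); split=> //;
      apply: fg_projective_prod.
  + by move=> f [h' h'P]; exists (h' \o fst) => x; rewrite h'P.
  + by exists snd.
  by exists h' => x; rewrite hg h'P.
move=> Q /fg_projective_retract [m [i [r iK]]] h.
have lin_c j : linear (fun x : free_mod R m => x j : R^o) by move=> a x y;
  rewrite !ffunE.
have [k kP] := boolp.choice (fun j => thruR (mk_linear (lin_c j) \o i \o h)).
have lin_k : linear (fun y => [ffun j => k j y] : free_mod R m).
  by move=> a x y; apply/ffunP => j; rewrite !ffunE linearP.
exists (r \o mk_linear lin_k) => x /=; rewrite -[LHS]iK; congr (r _).
by apply/ffunP => j; rewrite ffunE -kP.
Qed.

(** Dual to [left_projective_approx], with a cogenerator [E] in place of the ring. *)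
Lemma right_injective_approx Y : fin_gen Y ->
  exists (I : lmodType R) (phi : {linear I -> Y}), fg_injective I /\
  forall J, fg_injective J -> forall h : {linear J -> Y},
    exists h' : {linear J -> I}, forall x, h x = phi (h' x).
Proof.
move=> fY; have [E [injE EP]] := cogenerator_exists.
pose thru (I : lmodType R) (phi : {linear I -> Y}) : set {linear E -> Y} :=
  [set h | exists h' : {linear E -> I}, forall x, h x = phi (h' x)].
pose Phi H := exists (I : lmodType R) (phi : {linear I -> Y}),
  fg_injective I /\ H = thru I phi.
have [||_ [I [phi [fgI ->]]] maxI] := @hom_family_max E Y Phi injE.1 fY.
- move=> _ [I [phi [_ ->]]]; split=> [|f g [f' fP] [g' gP]|t f [f' fP]].
  + by exists \0 => x; rewrite /= linear0.
  + by exists (f' \- g') => x; rewrite /= fP gP linearB.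
  + exists (mk_linear (central_scale_linear t f)) => //.
    by exists (mk_linear (central_scale_linear t f')) => x; rewrite /= fP linearZ.
- by exists (thru E \0), E, \0.
exists I, phi; split=> //.
pose good (P : lmodType R) :=
  forall h : {linear P -> Y}, exists h' : {linear P -> I}, forall x,
    h x = phi (h' x).
have goodE : good E.
  move=> h.
  have lin_psi : linear (fun x : (I * E)%type => phi x.1 + h x.2).
    by move=> a x y; rewrite /= !linearP scalerDr addrACA.
  have [|||g [h' h'P] hg] := maxI (thru _ (mk_linear lin_psi)) _ _ h.
  + by exists (I * E)%type, (mk_linear lin_psi); split=> //;
      apply: fg_injective_prod.
  + move=> f [h' h'P].
    have lin_k : linear (fun x => (h' x, 0) : (I * E)%type).
      by move=> a x y; rewrite [RHS]surjective_pairing /= linearP scaler0 addr0.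
    by exists (mk_linear lin_k) => x; rewrite h'P /= linear0 addr0.
  + have lin_k : linear (fun x => (0, x) : (I * E)%type).
      by move=> a x y; rewrite [RHS]surjective_pairing /= scaler0 addr0.
    by exists (mk_linear lin_k) => x; rewrite /= linear0 add0r.
  by exists h' => x; rewrite hg h'P.
have good_prod (A B : lmodType R) : good A -> good B -> good (A * B)%type.
  move=> gA gB h.
  have lin1 : linear (fun x => (x, 0) : (A * B)%type).
    by move=> a x y; rewrite [RHS]surjective_pairing /= scaler0 addr0.
  have lin2 : linear (fun x => (0, x) : (A * B)%type).
    by move=> a x y; rewrite [RHS]surjective_pairing /= scaler0 addr0.
  have [h1 h1P] := gA (h \o mk_linear lin1).
  have [h2 h2P] := gB (h \o mk_linear lin2).
  exists ((h1 \o fst) \+ (h2 \o snd)) => -[x y] /=.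
  rewrite linearD -h1P -h2P /= -linearD; congr (h _).
  by rewrite [RHS]surjective_pairing /= addr0 add0r.
move=> J [fJ injJ] h.
have [n lenJ] := fin_gen_finite_length finR fJ.
(* Since [E] separates points and [good] is closed under products, a minimal kernel is zero: [J]
   embeds in a good module, and splits off by injectivity. *)
pose Psi (U : set J) :=
  exists (P : lmodType R) (f : {linear J -> P}), good P /\ U = [set x | f x = 0].
have [||_ [P [f [goodP ->]]] minP] := length_le_min (Phi := Psi) lenJ.
- move=> _ [P [f [_ ->]]]; apply: submod_op; split=> [|a x y /= fx fy].
    exact: linear0.
  by rewrite linearP fx fy scaler0 addr0.
- by exists [set x | (\0 : {linear J -> E}) x = 0] => //; exists E, \0.
have inj_f : injective f.
  apply: linear_inj => x fx; apply: contrapT => nx.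
  have [g gx] := EP J fJ x nx.
  have lin_k : linear (fun x => (f x, g x) : (P * E)%type) by move=> a y y';
    rewrite !linearP.
  apply: gx; apply: (congr1 snd (_ : (f x, g x) = 0)).
  apply: (minP [set x | mk_linear lin_k x = 0]) fx => [|y /(congr1 fst) //].
  by exists (P * E)%type, (mk_linear lin_k); split=> //; apply: good_prod.
have [r rP] := injJ _ _ f idfun inj_f.
have [h' h'P] := goodP (h \o r).
by exists (h' \o f) => x; rewrite /= -h'P /= -rP.
Qed.

End InjectiveHull.

(** * Totally acyclic complexes as two-sided sequences of modules *)

Section Complexes.
Variable R : pzRingType.
Implicit Types A B C I J K M P Q X Y Z : lmodType R.

(** One step of a complete resolution seen on cocycles: exactness of Hom(-,Q) becomes extension of
    maps along [f]. A totally acyclic complex is then a two-sided sequence of such steps. *)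
Definition proj_step Z Z' : Prop :=
  exists P (f : {linear Z -> P}) (g : {linear P -> Z'}),
    [/\ fg_projective P, short_exact f g &
      forall Q, fg_projective Q -> forall phi : {linear Z -> Q},
        exists psi : {linear P -> Q}, forall x, phi x = psi (f x)].

Definition inj_step Z Z' : Prop :=
  exists I (f : {linear Z -> I}) (g : {linear I -> Z'}),
    [/\ fg_injective I, short_exact f g &
      forall J, fg_injective J -> forall phi : {linear J -> Z'},
        exists psi : {linear J -> I}, forall x, phi x = g (psi x)].

Section OneComplex.
Variable (P : complex R).
Hypothesis acP : acyclic P.

Let incl j : {linear cocycles P j -> obj P j} := ker_incl (diff P j).
Let lift j : {linear obj P j -> cocycles P (j + 1)} := ker_lift (@diffK _ P j).

Lemma cocycles_lift_surj j : surjective (ker_lift (@diffK _ P j)).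
Proof.
case=> y Ky; have [x yx] : exists x, y = diff P j x by apply/acP/eqP.
by exists x; apply: val_inj.
Qed.

Lemma cocycles_lift0 j x : ker_lift (@diffK _ P j) x = 0 <-> diff P j x = 0.
Proof.
by split=> [/(congr1 val) //|dx0]; apply: val_inj.
Qed.

Lemma cocycles_short_exact j : short_exact (ker_incl (diff P j)) (ker_lift (@diffK
  _ P j)).
Proof.
split; [exact: ker_incl_inj | move=> y | exact: cocycles_lift_surj].
by rewrite cocycles_lift0; apply: ker_exact.
Qed.

Definition cocycles_extend Q j : Prop :=
  forall phi : {linear cocycles P j -> Q}, exists psi : {linear obj P j -> Q},
    forall x, phi x = psi (ker_incl (diff P j) x).

Definition cocycles_cover I j : Prop :=
  forall phi : {linear I -> cocycles P (j + 1)},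
  exists psi : {linear I -> obj P j}, forall x,
    phi x = ker_lift (@diffK _ P j) (psi x).

(** A map on P^(j+1) killing the image of P^j is a map on Z^(j+2), hence the shift by two. *)
Lemma exact_hom_to_extend Q j :
  exact_hom_to Q (diff P j) (diff P (j + 1)) <-> cocycles_extend Q (j + 1 + 1).
Proof.
split=> [ex phi|ext phi].
  have [|psi psiP] := (ex (phi \o lift (j + 1))).1.
    by move=> x; rewrite /= (_ : lift _ _ = 0) ?linear0 //;
      apply/cocycles_lift0/diffK.
  by exists psi => z; have [y ->] := cocycles_lift_surj z; rewrite [LHS]psiP.
split=> [phi0|[psi psiP] x]; last by rewrite psiP diffK linear0.
have [y /cocycles_lift0 /acP [x ->] //|h hP] := factor_surj (phi :=
  phi) (@cocycles_lift_surj (j + 1)).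
by have [psi psiP] := ext h; exists psi => y; rewrite hP psiP.
Qed.

Lemma exact_hom_from_cover I j :
  exact_hom_from I (diff P j) (diff P (j + 1)) <-> cocycles_cover I j.
Proof.
split=> [ex phi|cov phi].
  have [|psi psiP] := (ex (incl (j + 1) \o phi)).1.
    by move=> x /=; apply/eqP; case: (phi x).
  by exists psi => x; apply: val_inj; apply: psiP.
split=> [phi0|[psi psiP] x]; last by rewrite psiP diffK.
have [x|h hP] := factor_inj (phi := phi) (@ker_incl_inj _ _ _ (diff P (j + 1))).
  exact/ker_exact/phi0.
by have [psi psiP] := cov h; exists psi => x; rewrite hP psiP.
Qed.

(** The places at either end of the surjection onto the last cocycle module are exact by right
    exactness. Each other inner place P^(j+r-1) is a condition on Z^(j+r), whence the range of
    [r]. *)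
Lemma segment_tail_extend Q m j :
  chain_all (@exact_hom_to R Q) (segment_tail P m j) <->
  forall r : nat, (1 < r <= m)%N -> cocycles_extend Q (j + r%:Z).
Proof.
have last0 i : exact_hom_to Q (lift i) (\0 : {linear cocycles P (i + 1) -> zero_mod
  R}).
  move=> phi; split=> [phi0|[psi psiP] x]; last by rewrite psiP linear0.
  by exists \0 => z; have [y ->] := cocycles_lift_surj z; rewrite phi0.
elim: m j => [|m IHm] j /=.
  by split=> [_ r|_]; [case: r => [|[|]] | split=> //; apply: last0].
case: m IHm => [|m] IHm /=.
  split=> [_ r|_]; first by case: r => [|[|]].
  split; last by split=> //; apply: last0.
  move=> phi; split=> [phi0|[psi psiP] x]; last first.
    by rewrite psiP (cocycles_lift0 _).2 ?linear0 ?diffK.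
  apply: factor_surj; first exact: cocycles_lift_surj.
  by move=> y /cocycles_lift0 /acP [x ->].
have := IHm (j + 1) => /= ->; rewrite exact_hom_to_extend.
split=> [[e2 er] [|[|[|r]]] // /andP [_ rm]|er].
- by rewrite (_ : 2%:Z = 1 + 1) // addrA.
- by rewrite (intS r.+2) addrA; apply: er.
split=> [|r /andP [r1 rm]]; first by rewrite -addrA; apply: (er 2%N).
by rewrite -addrA -intS; apply: er; rewrite ltnS ltnW.
Qed.

Lemma segment_extend Q m j :
  chain_all (@exact_hom_to R Q) (segment P m.+1 j) <->
  forall r : nat, (r <= m)%N -> cocycles_extend Q (j + r%:Z).
Proof.
have head i : exact_hom_to Q (\0 : {linear zero_mod R -> cocycles P i}) (incl i) <->
    cocycles_extend Q i.
  by split=> [ex phi|ext phi]; [apply/ex => x; rewrite linear0 | split=> // _ x;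
    rewrite linear0].
have tailP := segment_tail_extend Q m j.
case: m tailP => [|m] tailP.
  rewrite /segment /=; split=> [[/head e0 _] [|//] _|er]; first by rewrite addr0.
  split; first by apply/head; have := er 0%N isT; rewrite addr0.
  split; last by apply/tailP => -[|[|]].
  move=> phi; split=> [phi0|[psi psiP] x]; last first.
    by rewrite psiP (_ : ker_lift _ _ = 0) ?linear0 //; apply/cocycles_lift0/eqP;
      case: x.
  apply: factor_surj; first exact: cocycles_lift_surj.
  move=> y /cocycles_lift0 /ker_exact [x ->]; exact: phi0.
have e1 : exact_hom_to Q (incl j) (diff P j) <-> cocycles_extend Q (j + 1).
  split=> [ex phi|ext phi].
    have [|psi psiP] := (ex (phi \o lift j)).1.
      by move=> x; rewrite /= (_ : lift _ _ = 0) ?linear0 //;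
        apply/cocycles_lift0/eqP; case: x.
    by exists psi => z; have [y ->] := cocycles_lift_surj z; rewrite [LHS]psiP.
  split=> [phi0|[psi psiP] x]; last first.
    by rewrite psiP (_ : diff P j _ = 0) ?linear0 //; apply/eqP; case: x.
  have [y /cocycles_lift0 /ker_exact [x ->] |h hP] := factor_surj (phi :=
    phi) (@cocycles_lift_surj j).
    exact: phi0.
  by have [psi psiP] := ext h; exists psi => y; rewrite hP psiP.
rewrite /segment /=; split=> [[/head e0 [/e1 e1' /tailP er]] [|[|r]] rm|er].
- by rewrite addr0.
- exact: e1'.
- exact: er.
split; first by apply/head; have := er 0%N isT; rewrite addr0.
split; first by apply/e1; apply: (er 1%N).
by apply/tailP => r /andP [_ rm]; apply: er.
Qed.

Lemma segment_tail_cover I m j :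
  chain_all (@exact_hom_from R I) (segment_tail P m j) <->
  forall r : nat, (r <= m)%N -> cocycles_cover I (j + r%:Z).
Proof.
elim: m j => [|m IHm] j.
  have last0 : exact_hom_from I (lift j) (\0 : {linear cocycles P (j + 1) ->
    zero_mod R}) <->
      cocycles_cover I j.
    by split=> [ex phi|cov phi]; [apply/ex | split].
  split=> [[/last0 cov _] [|//] _|cov]; first by rewrite addr0.
  by split=> //; apply/last0; have := cov 0%N isT; rewrite addr0.
have cov1 : (forall r : nat, (r <= m.+1)%N -> cocycles_cover I (j + r%:Z)) <->
    cocycles_cover I j /\ forall r : nat,
      (r <= m)%N -> cocycles_cover I (j + 1 + r%:Z).
  split=> [cov|[cov0 cov] [|r] rm].
  - split=> [|r rm]; first by have := cov 0%N isT; rewrite addr0.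
    by rewrite -addrA -intS; apply: cov.
  - by rewrite addr0.
  - by rewrite intS addrA; apply: cov.
rewrite cov1 -IHm; case: m {IHm cov1} => [|m] /=;
  last by rewrite exact_hom_from_cover.
have covE : exact_hom_from I (diff P j) (lift (j + 1)) <-> cocycles_cover I j.
  rewrite -exact_hom_from_cover; split=> ex phi; rewrite -ex.
    by split=> phi0 x; apply/cocycles_lift0/phi0.
  by split=> phi0 x; apply/cocycles_lift0/phi0.
by split=> [[/covE]|[/covE]].
Qed.

(** For Hom(I,-) it is the left end of the segment that is exact automatically. *)
Lemma segment_cover I m j :
  chain_all (@exact_hom_from R I) (segment P m.+1 j) <->
  forall r : nat, (r <= m)%N -> cocycles_cover I (j + r%:Z).
Proof.
rewrite -segment_tail_cover /segment; split=> [[_ [_]] //|tl].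
have head : exact_hom_from I (\0 : {linear zero_mod R -> cocycles P j}) (incl j).
  move=> phi; split=> [phi0|[psi psiP] x]; last by rewrite psiP linear0.
  by exists \0 => x; apply: val_inj; apply: phi0.
have left_exact C (g : {linear obj P j -> C}) : (forall x,
  g x = 0 <-> diff P j x = 0) ->
    exact_hom_from I (incl j) g.
  move=> gd phi; split=> [phi0|[psi psiP] x].
    by apply: factor_inj => [|x]; [apply: ker_incl_inj | apply/ker_exact/gd].
  by rewrite psiP; apply/gd/ker_exact; exists (psi x).
split=> //; split=> //; case: m tl => [|m] _ /=; apply: left_exact => // x.
exact: cocycles_lift0.
Qed.

Lemma cocycles_proj_step j : fg_projective (obj P j) ->
  (forall Q, fg_projective Q -> cocycles_extend Q j) ->
  proj_step (cocycles P j) (cocycles P (j + 1)).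
Proof.
by move=> fgP ext; exists (obj P j), (incl j), (lift j); split=> //;
  apply: cocycles_short_exact.
Qed.

Lemma cocycles_inj_step j : fg_injective (obj P j) ->
  (forall I, fg_injective I -> cocycles_cover I j) ->
  inj_step (cocycles P j) (cocycles P (j + 1)).
Proof.
by move=> fgP ext; exists (obj P j), (incl j), (lift j); split=> //;
  apply: cocycles_short_exact.
Qed.

End OneComplex.

(** * Splicing short exact sequences into an acyclic complex *)

Section Splice.
Variables (s P : int -> lmodType R).
Variables (f : forall j, {linear s j -> P j}) (g : forall j,
  {linear P j -> s (j + 1)}).
Hypothesis fg : forall j, short_exact (f j) (g j).

Lemma splice_diffK j x : (f (j + 1 + 1) \o g (j + 1)) ((f (j + 1) \o g j) x) = 0.
Proof. by have [_ ex _] := fg (j + 1); rewrite /= (exact_comp0 _ ex) linear0. Qed.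

Definition splice : complex R := Complex splice_diffK.

Lemma splice_kernel j x : diff splice j x = 0 <-> g j x = 0.
Proof.
split=> [/= fgx|gx]; last by rewrite /= gx linear0.
by have [inj_f _ _] := fg (j + 1); apply: inj_f; rewrite fgx linear0.
Qed.

Lemma splice_acyclic : acyclic splice.
Proof.
move=> j y; rewrite splice_kernel.
have [_ ex _] := fg (j + 1); have [_ _ sg] := fg j; rewrite ex.
split=> [[x ->]|[x ->]]; last by exists (g j x).
by have [z ->] := sg x; exists z.
Qed.

Lemma splice_in_kernel j x : f j x \in ker_pred (diff splice j).
Proof.
by rewrite inE; apply/eqP/splice_kernel; have [_ ex _] := fg j; apply: exact_comp0.
Qed.

Lemma splice_cocycle j (z : cocycles splice j) : exists x,
  ker_incl (diff splice j) z = f j x.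
Proof.
have [_ ex _] := fg j; apply/ex/splice_kernel; apply/ker_exact; by exists z.
Qed.

Lemma splice_cocycles j : isomorphic (s j) (cocycles splice j).
Proof.
have lin_h : linear (fun x => Sub (f j x) (splice_in_kernel x) : cocycles splice j).
  by move=> a x y; apply: val_inj; rewrite /= linearP.
apply: (iso_of_inj_surj (f := mk_linear lin_h)) => [x y /(congr1 val)|z].
  by have [inj_f _ _] := fg j; apply: inj_f.
by have [x zx] := splice_cocycle z; exists x; apply: val_inj.
Qed.

Lemma splice_extend Q j :
  (forall phi : {linear s j -> Q}, exists psi : {linear P j -> Q},
     forall x, phi x = psi (f j x)) -> cocycles_extend splice Q j.
Proof.
move=> ext phi.
have lin_h : linear (fun x => Sub (f j x) (splice_in_kernel x) : cocycles splice j).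
  by move=> a x y; apply: val_inj; rewrite /= linearP.
have [psi psiP] := ext (phi \o mk_linear lin_h).
exists psi => z; have [x zx] := splice_cocycle z;
  rewrite [RHS](congr1 psi zx) -psiP /=.
by congr (phi _); apply: val_inj.
Qed.

Lemma splice_cover I j :
  (forall phi : {linear I -> s (j + 1)}, exists psi : {linear I -> P j},
     forall x, phi x = g j (psi x)) -> cocycles_cover splice I j.
Proof.
move=> cov phi; have [inj_f _ _] := fg (j + 1).
have [x|h hP] := factor_inj (phi := ker_incl (diff splice (j + 1)) \o phi) inj_f.
  exact: splice_cocycle.
have [psi psiP] := cov h; exists psi => x; apply: val_inj.
by rewrite -[LHS]/((ker_incl (diff splice (j + 1)) \o phi) x) hP psiP.
Qed.

End Splice.

Lemma proj_complex_of_steps (s : int -> lmodType R) :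
  (forall j, proj_step (s j) (s (j + 1))) ->
  exists P : complex R, [/\ forall j, fg_projective (obj P j), acyclic P,
    forall Q, fg_projective Q -> forall j, cocycles_extend P Q j
  & forall j, isomorphic (s j) (cocycles P j)].
Proof.
move=> step; pose P j := sval (cid (step j)).
pose f j : {linear s j -> P j} := sval (cid (svalP (cid (step j)))).
pose g j : {linear P j -> s (j + 1)} :=
  sval (cid (svalP (cid (svalP (cid (step j)))))).
have H j : [/\ fg_projective (P j), short_exact (f j) (g j) &
      forall Q, fg_projective Q -> forall phi : {linear s j -> Q},
        exists psi : {linear P j -> Q}, forall x, phi x = psi (f j x)].
  exact: (svalP (cid (svalP (cid (svalP (cid (step j))))))).
have fg j : short_exact (f j) (g j) by case: (H j).
exists (splice fg); split=> [j||Q fgQ j|j].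
- by case: (H j).
- exact: splice_acyclic.
- by apply: splice_extend; case: (H j) => _ _; apply.
- exact: splice_cocycles.
Qed.

Lemma inj_complex_of_steps (s : int -> lmodType R) :
  (forall j, inj_step (s j) (s (j + 1))) ->
  exists P : complex R, [/\ forall j, fg_injective (obj P j), acyclic P,
    forall J, fg_injective J -> forall j, cocycles_cover P J j
  & forall j, isomorphic (s j) (cocycles P j)].
Proof.
move=> step; pose P j := sval (cid (step j)).
pose f j : {linear s j -> P j} := sval (cid (svalP (cid (step j)))).
pose g j : {linear P j -> s (j + 1)} :=
  sval (cid (svalP (cid (svalP (cid (step j)))))).
have H j : [/\ fg_injective (P j), short_exact (f j) (g j) &
      forall J, fg_injective J -> forall phi : {linear J -> s (j + 1)},
        exists psi : {linear J -> P j}, forall x, phi x = g j (psi x)].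
  exact: (svalP (cid (svalP (cid (svalP (cid (step j))))))).
have fg j : short_exact (f j) (g j) by case: (H j).
exists (splice fg); split=> [j||Q fgQ j|j].
- by case: (H j).
- exact: splice_acyclic.
- by apply: splice_cover; case: (H j) => _ _; apply.
- exact: splice_cocycles.
Qed.

Lemma Gprj_steps X : Gprj X <-> exists s : int -> lmodType R,
  isomorphic X (s 0) /\ forall j, proj_step (s j) (s (j + 1)).
Proof.
split=> [[P [[fgP acP ex] [j0 Xj]]]|[s [Xs /proj_complex_of_steps [P [fgP acP ext
  sP]]]]].
  exists (fun j => cocycles P (j0 + j)); split=> [|j]; first by rewrite addr0.
  rewrite addrA; apply: cocycles_proj_step => // Q fgQ.
  by rewrite -[j0 + j](subrK 1) -[_ - 1](subrK 1); apply/exact_hom_to_extend/ex.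
exists P; split; last by exists 0; apply: isomorphic_trans Xs _.
by split=> // Q fgQ j; apply/exact_hom_to_extend/ext.
Qed.

Lemma Ginj_steps X : Ginj X <-> exists s : int -> lmodType R,
  isomorphic X (s 0) /\ forall j, inj_step (s j) (s (j + 1)).
Proof.
split=> [[P [[fgP acP ex] [j0 Xj]]]|[s [Xs /inj_complex_of_steps [P [fgP acP ext
  sP]]]]].
  exists (fun j => cocycles P (j0 + j)); split=> [|j]; first by rewrite addr0.
  rewrite addrA; apply: cocycles_inj_step => // I fgI.
  exact/exact_hom_from_cover/ex.
exists P; split; last by exists 0; apply: isomorphic_trans Xs _.
by split=> // Q fgQ j; apply/exact_hom_from_cover/ext.
Qed.

Section NZSteps.
Variables (n : nat) (C : lmodType R -> Prop).
Hypothesis n_gt0 : (0 < n)%N.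
Hypothesis C_iso : forall X Y, isomorphic X Y -> C X -> C Y.

(** Every degree lies in one block of length [n], so the segment conditions at multiples of [n]
    together reach all degrees. *)
Lemma int_block (j : int) : exists i (r : nat), (r < n)%N /\ j = i * n%:Z + r%:Z.
Proof.
have nz : (n%:Z != 0 :> int) by rewrite -lt0n.
exists (j %/ n%:Z)%Z, `|(j %% n%:Z)%Z|%N.
by rewrite -ltz_nat gez0_abs ?modz_ge0 // -divz_eq ltz_pmod.
Qed.

Lemma nZ_Gprj_steps X : nZ_Gprj n C X <-> C X /\ exists s : int -> lmodType R,
  [/\ isomorphic X (s 0), forall j, proj_step (s j) (s (j + 1)) &
      forall i : int, C (s (i * n%:Z))].
Proof.
split=> [[CX [P [[fgP acP ex CP] [i0 Xj]]]]|[CX [s [Xs /proj_complex_of_steps [P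
  [fgP acP ext sP]] Cs]]]].
  split=> //; exists (fun j => cocycles P (i0 * n%:Z + j)); split=> [|j|i].
  - by rewrite addr0.
  - rewrite addrA; apply: cocycles_proj_step => // Q fgQ.
    have [i [r [rn ->]]] := int_block (i0 * n%:Z + j).
    have := ex i Q fgQ; rewrite -(prednK n_gt0) => /(segment_extend acP).
    by rewrite (prednK n_gt0); apply; rewrite -ltnS prednK.
  - by rewrite -mulrDl.
split=> //; exists P; split; last by exists 0; rewrite mul0r;
  apply: isomorphic_trans Xs _.
split=> // [i Q fgQ|i]; last exact: C_iso (Cs i).
by rewrite -(prednK n_gt0); apply/(segment_extend acP) => r _; apply: ext.
Qed.

Lemma nZ_Ginj_steps X : nZ_Ginj n C X <-> C X /\ exists s : int -> lmodType R,
  [/\ isomorphic X (s 0), forall j, inj_step (s j) (s (j + 1)) &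
      forall i : int, C (s (i * n%:Z))].
Proof.
split=> [[CX [P [[fgP acP ex CP] [i0 Xj]]]]|[CX [s [Xs /inj_complex_of_steps [P
  [fgP acP ext sP]] Cs]]]].
  split=> //; exists (fun j => cocycles P (i0 * n%:Z + j)); split=> [|j|i].
  - by rewrite addr0.
  - rewrite addrA; apply: cocycles_inj_step => // Q fgQ.
    have [i [r [rn ->]]] := int_block (i0 * n%:Z + j).
    have := ex i Q fgQ; rewrite -(prednK n_gt0) => /segment_cover.
    by rewrite (prednK n_gt0); apply; rewrite -ltnS prednK.
  - by rewrite -mulrDl.
split=> //; exists P; split; last by exists 0; rewrite mul0r;
  apply: isomorphic_trans Xs _.
split=> // [i Q fgQ|i]; last exact: C_iso (Cs i).
by rewrite -(prednK n_gt0); apply/segment_cover => r _; apply: ext.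
Qed.

End NZSteps.

End Complexes.

Lemma two_sided_sequence (T : Type) (step : T -> T -> Prop) (t0 : T) :
  (forall t, exists u, step t u) -> (forall t, exists u, step u t) ->
  exists s : int -> T, s 0 = t0 /\ forall j, step (s j) (s (j + 1)).
Proof.
move=> /boolp.choice [next nextP] /boolp.choice [prev prevP].
(* [Negz n] is -(n+1), hence the [n.+1] backward iterations. *)
exists (fun j => match j with Posz n => iter n next t0 | Negz n => iter n.+1 prev
  t0 end).
split=> // -[m|[|m]]; first by rewrite -PoszD addn1; apply: nextP.
  exact: prevP.
have -> : Negz m.+1 + 1 = Negz m by rewrite !NegzE -[m.+2]addn1 PoszD opprD addrNK.
exact: prevP.
Qed.

(** * Cluster tilting subcategories over Gorenstein rings *)

Section Steps.
Variable R : pzRingType.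
Implicit Types A B E I J K M P Q X Y Z : lmodType R.
Hypothesis noeth : noetherian R.
Hypothesis enough_inj : enough_fg_injectives R.

Lemma Ext_zero0 X Y : Ext_zero 0 X Y <-> Ext1 X Y.
Proof.
by split=> [|ext K XK]; [apply; apply: isomorphic_refl | apply: Ext1_isol ext].
Qed.

Lemma Ext_zero_injective i X Y : injective_mod Y -> Ext_zero i X Y.
Proof. by move=> injY K _; apply: Ext1_injective. Qed.

(** When Ext(X,-) kills projectives, a syzygy in the second argument raises the degree, as a
    cosyzygy lowers it. *)
Lemma Ext_zero_syzygyr k i X Y K :
    fin_gen X -> fin_gen Y -> syzygy k Y K ->
    (forall Q, fg_projective Q -> forall j, Ext_zero j X Q) ->
  Ext_zero i X Y <-> Ext_zero (k + i) X K.
Proof.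
move=> fX + + extX; elim: k Y i => [|k IHk] Y i fY /=.
  by move=> YK; split=> ext M XM; have := ext M XM; apply: Ext1_isor => //;
    apply: isomorphic_sym.
move=> [P [p [fgP sp pK]]].
have fp : fin_gen (Ker p) by apply: noeth (@ker_incl_inj _ _ _ p) fgP.1.
rewrite addSnnS -(IHk (Ker p)) //.
apply: (Ext_zero_dimshiftr noeth enough_inj _ fX fp fY (ker_short_exact sp)).
by move=> j; apply: extX.
Qed.

Lemma Ext_zero_cosyzygyl k i X Y K :
    fin_gen X -> fin_gen Y -> cosyzygy k X K ->
    (forall J, fg_injective J -> forall j, Ext_zero j J Y) ->
  Ext_zero i X Y <-> Ext_zero (k + i) K Y.
Proof.
move=> + fY + extY; elim: k X i => [|k IHk] X i fX /=.
  move=> XK; have [Z YZ _] := icosyz_exists enough_inj i fY.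
  rewrite -(Ext_zero_icosyz noeth enough_inj fX fY YZ).
  rewrite -(Ext_zero_icosyz noeth enough_inj (fin_gen_iso XK fX) fY YZ).
  by split; apply: Ext1_isol => //; apply: isomorphic_sym.
move=> [J [E [f [g [fgJ fg EK]]]]]; have [_ _ sg] := fg.
have fE := fin_gen_surj sg fgJ.1.
rewrite addSnnS -(IHk E) //.
apply: (Ext_zero_dimshiftl noeth enough_inj _ fE fY fgJ.1 fX fg).
by move=> j; apply: extY.
Qed.

Section Sequence.
Variable s : int -> lmodType R.

Section Proj.
Hypothesis step : forall j, proj_step (s j) (s (j + 1)).

Lemma proj_steps_fin_gen j : fin_gen (s j).
Proof. by have [P [f [g [[fP _] [inj_f _ _] _]]]] := step j;
  apply: noeth inj_f fP. Qed.

Lemma proj_steps_psyz i j : psyz i (s (j + i%:Z)) (s j).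
Proof.
elim: i j => [|i IHi] j; first by rewrite addr0; apply: isomorphic_refl.
rewrite intS addrA; exists (s (j + 1)) => //.
by have [P [f [g [[_ projP] fg _]]]] := step j; exists P, f, g.
Qed.

(** The i-th syzygy of [s j] is [s (j - i)], and the step ending there extends maps into [Q]. *)
Lemma proj_steps_Ext_zero i j Q : fg_projective Q -> Ext_zero i (s j) Q.
Proof.
move=> fgQ; apply/(Ext_zero_psyz enough_inj fgQ.1 (K := s (j - i%:Z))).
  by have := proj_steps_psyz i (j - i%:Z); rewrite subrK.
have [P [f [g [[_ projP] fg ext]]]] := step (j - i%:Z - 1).
rewrite subrK in g fg; apply: Ext1_of_extend fg _ _; last exact: ext.
exact: Ext1_projective.
Qed.

End Proj.

Section Inj.
Hypothesis step : forall j, inj_step (s j) (s (j + 1)).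

Lemma inj_steps_fin_gen j : fin_gen (s j).
Proof. by have [P [f [g [[fP _] [inj_f _ _] _]]]] := step j;
  apply: noeth inj_f fP. Qed.

Lemma inj_steps_icosyz i j : icosyz i (s j) (s (j + i%:Z)).
Proof.
elim: i j => [|i IHi] j; first by rewrite addr0; apply: isomorphic_refl.
rewrite intS addrA; exists (s (j + 1)) => //.
by have [P [f [g [[_ projP] fg _]]]] := step j; exists P, f, g.
Qed.

Lemma inj_steps_Ext_zero i j J : fg_injective J -> Ext_zero i J (s j).
Proof.
move=> fgJ; have fs := inj_steps_fin_gen.
apply/(Ext_zero_icosyz noeth enough_inj fgJ.1 (fs j) (inj_steps_icosyz i j)).
have [I [f [g [[_ injI] fg lift]]]] := step (j + i%:Z).
by apply: Ext1_of_lift fg _ _; [apply: Ext1_injective | apply: lift].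
Qed.

End Inj.
End Sequence.

Lemma syzygy_split k m X K :
  syzygy (k + m) X K -> exists2 Y, syzygy k X Y & syzygy m Y K.
Proof.
elim: k X => [|k IHk] X; first by move=> XK; exists X => //; apply: isomorphic_refl.
by move=> [P [p [fgP sp /IHk [Y KY YK]]]]; exists Y => //; exists P, p.
Qed.

Lemma cosyzygy_split k m X K :
  cosyzygy (k + m) X K -> exists2 Y, cosyzygy k X Y & cosyzygy m Y K.
Proof.
elim: k X => [|k IHk] X; first by move=> XK; exists X => //; apply: isomorphic_refl.
by move=> [I [E [f [g [fgI fg /IHk [Y EY YK]]]]]]; exists Y => //;
  exists I, E, f, g.
Qed.

(** * Cluster tilting subcategories and complete resolutions *)

Section ClusterTilting.
Variables (n : nat) (C : lmodType R -> Prop).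
Hypothesis n_gt0 : (0 < n)%N.
Hypothesis ctC : nZ_cluster_tilting C n.

Lemma ct_fin_gen X : C X -> fin_gen X.
Proof. by case: ctC => [[_ CP _] _] /CP []. Qed.

Lemma ct_Ext_zero i M N : ~~ (n %| i.+1)%N -> C M -> C N -> Ext_zero i M N.
Proof.
move=> ni CM CN; case: ctC => _ ext.
by apply/(Ext_vanishesP noeth enough_inj i (ct_fin_gen CM) (ct_fin_gen CN));
  apply: ext.
Qed.

Lemma ct_of_left X : fin_gen X ->
  (forall i M, (i.+1 < n)%N -> C M -> Ext_zero i M X) -> C X.
Proof.
move=> fX ext; case: ctC => [[_ CP _] _]; apply/CP; split=> // -[//|i] M i_n CM.
apply/(Ext_vanishesP noeth enough_inj i (ct_fin_gen CM) fX).
exact: ext.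
Qed.

Lemma ct_of_right X : fin_gen X ->
  (forall i M, (i.+1 < n)%N -> C M -> Ext_zero i X M) -> C X.
Proof.
move=> fX ext; case: ctC => [[_ _ CP] _]; apply/CP; split=> // -[//|i] M i_n CM.
apply/(Ext_vanishesP noeth enough_inj i fX (ct_fin_gen CM)).
exact: ext.
Qed.

Lemma ndvd_block i : (i.+1 < n)%N -> ~~ (n %| (n + i).+1)%N.
Proof. by move=> i_n; rewrite -addnS dvdn_addr // gtnNdvd. Qed.

(** Degrees 0 < i < n for [K] are degrees n + i for [X], none divisible by [n]. *)
Lemma ct_psyz X K : C X -> fin_gen K -> psyz n X K -> C K.
Proof.
move=> CX fK XK; apply: ct_of_right => // i M i_n CM.
apply/(Ext_zero_shiftl noeth enough_inj i fK (ct_fin_gen CM) XK).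
by apply: ct_Ext_zero => //; apply: ndvd_block.
Qed.

Lemma ct_icosyz X K : C X -> fin_gen K -> icosyz n X K -> C K.
Proof.
move=> CX fK XK; apply: ct_of_left => // i M i_n CM.
apply/(Ext_zero_shiftr noeth enough_inj i (ct_fin_gen CM) (ct_fin_gen CX) fK XK).
by apply: ct_Ext_zero => //; apply: ndvd_block.
Qed.

Lemma ct_iso X Y : isomorphic X Y -> C X -> C Y.
Proof.
move=> XY CX; apply: ct_of_left => [|i M i_n CM].
  exact: fin_gen_iso XY (ct_fin_gen CX).
move=> K MK; apply: Ext1_isor XY _; apply: ct_Ext_zero MK => //.
by rewrite gtnNdvd.
Qed.

Lemma ct_syzygy i X K : C X -> syzygy (i * n) X K -> C K.
Proof.
elim: i X => [|i IHi] X CX; first by move=> XK; apply: ct_iso XK CX.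
move=> /syzygy_split [Y XY /IHi]; apply; apply: (ct_psyz CX _ (syzygy_psyz XY)).
exact: (syzygy_fin_gen noeth (ct_fin_gen CX) XY).
Qed.

Lemma ct_cosyzygy i X K : C X -> cosyzygy (i * n) X K -> C K.
Proof.
elim: i X => [|i IHi] X CX; first by move=> XK; apply: ct_iso XK CX.
move=> /cosyzygy_split [Y XY /IHi]; apply;
  apply: (ct_icosyz CX _ (cosyzygy_icosyz XY)).
exact: (cosyzygy_fin_gen (ct_fin_gen CX) XY).
Qed.

Lemma int_block_ind (Phi : int -> Prop) :
    Phi 0 -> (forall i, Phi i -> Phi (i + 1)) -> (forall i, Phi (i + 1) -> Phi i) ->
  forall i, Phi i.
Proof.
move=> Phi0 up down; elim/int_ind => // m Phim; first by rewrite intS addrC;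
  apply: up.
by apply: down; rewrite -addn1 PoszD opprD addrNK.
Qed.

(* Ext^i(Z^n, M) = Ext^(i+n)(Z^n, Omega^n M) = Ext^i(Z^0, Omega^n M). *)
Lemma ct_proj_steps (s : int -> lmodType R) :
    (forall j, proj_step (s j) (s (j + 1))) -> C (s 0) ->
  forall i : int, C (s (i * n%:Z)).
Proof.
move=> step Cs0; have fs := proj_steps_fin_gen step.
apply: int_block_ind => [|i Ci|i]; first by rewrite mul0r.
  rewrite mulrDl mul1r; set j := i * n%:Z in Ci *.
  apply: ct_of_right => // r M r_n CM; have fM := ct_fin_gen CM.
  have [M' MM'] := syzygy_exists noeth n fM.
  have CM' : C M' by apply: (@ct_syzygy 1 M); rewrite ?mul1n.
  have fM' := ct_fin_gen CM'.
  rewrite (Ext_zero_syzygyr r (fs _) fM MM'); last first.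
    by move=> Q fgQ r'; apply: proj_steps_Ext_zero.
  rewrite (Ext_zero_shiftl noeth enough_inj r (fs j) fM' (proj_steps_psyz step n
    j)).
  by apply: ct_Ext_zero => //; rewrite gtnNdvd.
rewrite mulrDl mul1r => Ci; apply: ct_psyz Ci (fs _) _.
exact: proj_steps_psyz.
Qed.

(** Leftward, [Omega^(-n) M] plays the role of [Omega^n M] in the projective case: for 0 < r < n,
    Ext^r(M, Z^j) = Ext^(r+n)(Omega^(-n) M, Z^j) = Ext^r(Omega^(-n) M, Z^(j+n)) = 0. Rightward,
    cocycles are n-th cosyzygies. *)
Lemma ct_inj_steps (s : int -> lmodType R) :
    (forall j, inj_step (s j) (s (j + 1))) -> C (s 0) ->
  forall i : int, C (s (i * n%:Z)).
Proof.
move=> step Cs0; have fs := inj_steps_fin_gen step.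
apply: int_block_ind => [|i|i]; first by rewrite mul0r.
  rewrite mulrDl mul1r => Ci; apply: ct_icosyz Ci (fs _) _.
  exact: inj_steps_icosyz.
rewrite mulrDl mul1r; set j := i * n%:Z => Ci.
apply: ct_of_left => // r M r_n CM; have fM := ct_fin_gen CM.
have [M' MM'] := cosyzygy_exists enough_inj n fM.
have CM' : C M' by apply: (@ct_cosyzygy 1 M); rewrite ?mul1n.
have fM' := ct_fin_gen CM'.
rewrite (Ext_zero_cosyzygyl r fM (fs _) MM'); last first.
  by move=> J fgJ r'; apply: inj_steps_Ext_zero.
rewrite (Ext_zero_shiftr noeth enough_inj r fM' (fs j) (fs _) (inj_steps_icosyz
  step n j)).
by apply: ct_Ext_zero => //; rewrite gtnNdvd.
Qed.

Lemma ct_nZ_Gprj X : nZ_Gprj n C X <-> Gprj X /\ C X.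
Proof.
rewrite (nZ_Gprj_steps n_gt0 ct_iso) Gprj_steps.
split=> [[CX [s [Xs step _]]]|[[s [Xs step]] CX]]; split=> //; exists s => //.
split=> //; apply: ct_proj_steps => //; exact: ct_iso Xs CX.
Qed.

Lemma ct_nZ_Ginj X : nZ_Ginj n C X <-> Ginj X /\ C X.
Proof.
rewrite (nZ_Ginj_steps n_gt0 ct_iso) Ginj_steps.
split=> [[CX [s [Xs step _]]]|[[s [Xs step]] CX]]; split=> //; exists s => //.
split=> //; apply: ct_inj_steps => //; exact: ct_iso Xs CX.
Qed.

End ClusterTilting.

(** * Orthogonality to the ring and to injectives under finite injective dimension *)

Section Gorenstein.
Variable d : nat.
Hypothesis injdimR : injdim_le d (R^o : lmodType R).
Hypothesis fgR : fg_projective (R^o : lmodType R).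

Definition proj_perp X : Prop := fin_gen X /\ forall i, Ext_zero i X R^o.

Definition inj_perp Y : Prop :=
  fin_gen Y /\ forall I, fg_injective I -> forall i, Ext_zero i I Y.

Hypothesis torsionless : forall X, proj_perp X ->
  forall x : X, (forall f : {linear X -> R^o}, f x = 0) -> x = 0.

Hypothesis left_approx : forall K, fin_gen K ->
  exists P (phi : {linear K -> P}), fg_projective P /\
  forall Q, fg_projective Q -> forall h : {linear K -> Q},
    exists h' : {linear P -> Q}, forall x, h x = h' (phi x).

Hypothesis right_approx : forall Y, fin_gen Y ->
  exists I (phi : {linear I -> Y}), fg_injective I /\
  forall J, fg_injective J -> forall h : {linear J -> Y},
    exists h' : {linear J -> I}, forall x, h x = phi (h' x).

Lemma psyz_proj_perp m X K : (d <= m)%N -> fin_gen K -> psyz m X K -> proj_perp K.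
Proof.
move=> dm fK XK; split=> // i M KM; apply: injdim_Ext1 injdimR (psyz_cat XK KM).
exact: leq_trans dm (leq_addr _ _).
Qed.

Lemma proj_perp_Ext_zero X Q i : proj_perp X -> fg_projective Q -> Ext_zero i X Q.
Proof. by move=> [_ ext] fgQ K XK; apply: Ext1_fg_projective fgQ (ext i K XK). Qed.

(** The approximation is injective because functionals separate points and factor through it. Its
    extension property gives degree one for the cokernel; higher degrees are shifted from [X]. *)
Lemma proj_perp_step X : proj_perp X -> exists2 X', proj_perp X' & proj_step X X'.
Proof.
move=> perpX; have [P [phi [fgP phiP]]] := left_approx perpX.1.
have inj_phi : injective phi.
  apply: linear_inj => x phix; apply: torsionless => // f.
  by have [h ->] := phiP _ fgR f; rewrite phix linear0.
have [X' [g fg]] := cokernel_exists inj_phi; have [_ _ sg] := fg.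
have fX' := fin_gen_surj sg fgP.1.
exists X'; last by exists P, phi, g; split=> // Q /phiP.
have XX' : psyz 1 X' X by apply: psyz1; exists P, phi, g; split=> //; case: fgP.
split=> // -[|i].
  apply/Ext_zero0; apply: Ext1_of_extend fg (Ext1_projective fgP.2) _.
  exact: phiP.
exact/(Ext_zero_shiftl noeth enough_inj i perpX.1 fgR.1 XX')/perpX.2.
Qed.

Lemma proj_perp_step_back X : proj_perp X -> exists2 X',
  proj_perp X' & proj_step X' X.
Proof.
move=> perpX; have [P [p [fgP sp]]] := fg_projective_cover perpX.1.
have fg := ker_short_exact sp.
have fK : fin_gen (Ker p) by apply: noeth (@ker_incl_inj _ _ _ p) fgP.1.
have XK : psyz 1 X (Ker p) by apply: psyz1; exists P, (ker_incl p), p; split=> //;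
  case: fgP.
exists (Ker p).
  split=> // i; apply/(Ext_zero_shiftl noeth enough_inj i fK fgR.1 XK).
  exact: perpX.2.
exists P, (ker_incl p), p; split=> // Q fgQ; apply: (_ : Ext1 X Q) fg.
exact/Ext_zero0/proj_perp_Ext_zero.
Qed.

Lemma proj_perp_Gprj X : proj_perp X -> Gprj X.
Proof.
move=> perpX; apply/Gprj_steps; pose T := {X | proj_perp X}.
have [[Y perpY]|[Y perpY]|s [s0 step]] :=
    @two_sided_sequence T (fun u v => proj_step (sval u) (sval v)) (exist proj_perp
      X perpX).
- by have [Z perpZ YZ] := proj_perp_step perpY; exists (exist proj_perp Z perpZ).
- by have [Z perpZ YZ] := proj_perp_step_back perpY;
    exists (exist proj_perp Z perpZ).
by exists (fun j => sval (s j)); rewrite s0; split=> //; apply: isomorphic_refl.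
Qed.

Lemma proj_perp_psyz k X : proj_perp X -> exists2 X', proj_perp X' & psyz k X' X.
Proof.
elim: k X => [|k IHk] X perpX; first by exists X => //; apply: isomorphic_refl.
have [Y /IHk [X' perpX' X'Y] [P [f [g [[_ projP] fg _]]]]] := proj_perp_step perpX.
by exists X' => //; exists Y => //; exists P, f, g.
Qed.

(* K embeds in a projective with cokernel K' = Omega^d G, and the embedding splits:
   Ext^1(K', K) = Ext^(d+1)(G, Omega^d J) = Ext^1(G, J) = 0. *)
Lemma fg_injective_projdim J K : fg_injective J -> syzygy d J K -> projective K.
Proof.
move=> [fJ injJ] JK; have fK := syzygy_fin_gen noeth fJ JK.
have perpK : proj_perp K by apply: psyz_proj_perp (leqnn d) fK (syzygy_psyz JK).
have [K' perpK' [P [f [g [[fP projP] fg _]]]]] := proj_perp_step perpK.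
have [G perpG GK'] := proj_perp_psyz d perpK'.
have extK : Ext1 K' K.
  apply: (_ : Ext_zero d G K) GK'; rewrite -[d]addn0.
  apply/(Ext_zero_syzygyr 0 perpG.1 fJ JK); last exact: Ext_zero_injective.
  by move=> Q fgQ j; apply: proj_perp_Ext_zero.
have [r rP] := extK _ _ _ _ fg idfun.
move=> A B p h sp; have [k kP] := projP _ _ p (h \o r) sp.
by exists (k \o f) => x; rewrite /= -kP /= -rP.
Qed.

Lemma fg_injective_Ext_zero i J X : fg_injective J -> fin_gen X ->
  (d <= i)%N -> Ext_zero i J X.
Proof.
move=> fgJ fX /subnKC <-; have [K JK] := syzygy_exists noeth d fgJ.1.
have fK := syzygy_fin_gen noeth fgJ.1 JK.
apply/(Ext_zero_shiftl noeth enough_inj _ fK fX (syzygy_psyz JK)).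
exact: Ext_zero_projective (fg_injective_projdim fgJ JK).
Qed.

Lemma icosyz_inj_perp m X K :
  (d <= m)%N -> fin_gen X -> fin_gen K -> icosyz m X K -> inj_perp K.
Proof.
move=> dm fX fK XK; split=> // J fgJ i.
apply/(Ext_zero_shiftr noeth enough_inj i fgJ.1 fX fK XK).
by apply: fg_injective_Ext_zero => //; apply: leq_trans dm (leq_addr _ _).
Qed.

Lemma inj_perp_step Y : inj_perp Y -> exists2 Y', inj_perp Y' & inj_step Y Y'.
Proof.
move=> [fY extY]; have [J [f [fgJ inj_f]]] := enough_inj fY.
have [Y' [g fg]] := cokernel_exists inj_f; have [_ _ sg] := fg.
have fY' := fin_gen_surj sg fgJ.1.
have YY' : icosyz 1 Y Y' by apply: icosyz1; exists J, f, g; split=> //; case: fgJ.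
exists Y'.
  split=> // I fgI i; apply/(Ext_zero_shiftr noeth enough_inj i fgI.1 fY fY' YY').
  exact: extY.
exists J, f, g; split=> // I fgI phi; apply: Ext1_lift fg.
exact/Ext_zero0/extY.
Qed.

(** A projective [P] covering [Y] has injective (d+1)-th cosyzygy [Z]. For the first cosyzygy [E],
    Ext^1(E,Y) = Ext^(d+1)(Z,Y) = 0, so the cover extends to the injective [J] containing [P]. *)
Lemma inj_perp_surj Y : inj_perp Y ->
  exists J (q : {linear J -> Y}), fg_injective J /\ surjective q.
Proof.
move=> [fY extY]; have [P [p [fgP sp]]] := fg_projective_cover fY.
have [Z PZ] := cosyzygy_exists enough_inj d.+1 fgP.1.
have fZ := cosyzygy_fin_gen fgP.1 PZ.
have injZ : injective_mod Z.
  apply: (injective_of_Ext1 enough_inj fZ) => X fX.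
  apply/(Ext_zero_icosyz noeth enough_inj fX fgP.1 (cosyzygy_icosyz PZ)) => M XM.
  by apply: Ext1_fg_projective => //; apply: injdim_Ext1 injdimR XM.
have [J [E [f [g [fgJ fg EZ]]]]] := PZ; have [_ _ sg] := fg.
have fE := fin_gen_surj sg fgJ.1.
have extE : Ext1 E Y.
  apply/Ext_zero0/(Ext_zero_cosyzygyl 0 fE fY EZ) => //.
  by apply: extY.
have [q qP] := extE _ _ _ _ fg p.
exists J, q; split=> // y; have [x ->] := sp y; exists (f x); exact: qP.
Qed.

(** The approximation inherits surjectivity from any surjection of an injective onto [Y], and its
    lifting property gives degree one for the kernel. *)
Lemma inj_perp_step_back Y : inj_perp Y -> exists2 Y', inj_perp Y' & inj_step Y' Y.
Proof.
move=> perpY; have [fY extY] := perpY.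
have [I [phi [fgI phiP]]] := right_approx fY.
have sphi : surjective phi.
  have [J [q [fgJ sq]]] := inj_perp_surj perpY; have [h hP] := phiP J fgJ q.
  by move=> y; have [x ->] := sq y; exists (h x); apply: hP.
have fg := ker_short_exact sphi.
have fK : fin_gen (Ker phi) by apply: noeth (@ker_incl_inj _ _ _ phi) fgI.1.
have KY : icosyz 1 (Ker phi) Y by apply: icosyz1; exists I, (ker_incl phi), phi;
  split=> //; case: fgI.
exists (Ker phi); last by exists I, (ker_incl phi), phi; split=> // J /phiP.
split=> // J fgJ [|i].
  apply/Ext_zero0; apply: Ext1_of_lift fg (Ext1_injective fgI.2) _.
  exact: phiP.
by apply/(Ext_zero_shiftr noeth enough_inj i fgJ.1 fK fY KY); apply: extY.
Qed.

Lemma inj_perp_Ginj Y : inj_perp Y -> Ginj Y.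
Proof.
move=> perpY; apply/Ginj_steps; pose T := {Y | inj_perp Y}.
have [[X perpX]|[X perpX]|s [s0 step]] :=
    @two_sided_sequence T (fun u v => inj_step (sval u) (sval v)) (exist inj_perp Y
      perpY).
- by have [Z perpZ YZ] := inj_perp_step perpX; exists (exist inj_perp Z perpZ).
- by have [Z perpZ YZ] := inj_perp_step_back perpX; exists (exist inj_perp Z perpZ).
by exists (fun j => sval (s j)); rewrite s0; split=> //; apply: isomorphic_refl.
Qed.

Lemma gorenstein_nZ_G_cluster_tilting n (C : lmodType R -> Prop) :
  (0 < n)%N -> nZ_cluster_tilting C n -> nZ_G_cluster_tilting n C.
Proof.
move=> n_gt0 ctC; have d_le : (d <= d * n)%N by rewrite leq_pmulr.
(* [d] blocks suffice because [d * n] is at least [d]. *)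
split=> // X CX; exists d; have fX := ct_fin_gen ctC CX; split.
- exact: syzygy_exists.
- move=> K XK; apply/(ct_nZ_Gprj n_gt0 ctC); split; last exact: ct_syzygy CX XK.
  apply: proj_perp_Gprj; apply: (psyz_proj_perp d_le _ (syzygy_psyz XK)).
  exact: (syzygy_fin_gen noeth fX XK).
- exact: cosyzygy_exists.
- move=> K XK; apply/(ct_nZ_Ginj n_gt0 ctC); split; last exact: ct_cosyzygy CX XK.
  apply: inj_perp_Ginj; apply: (icosyz_inj_perp d_le fX _ (cosyzygy_icosyz XK)).
  exact: (cosyzygy_fin_gen fX XK).
Qed.

End Gorenstein.
End Steps.

(** * Duality between left and right modules *)

Section Duality.
Variable L : pzRingType.
Let R : pzRingType := L^c.
Implicit Types K P X Y : lmodType R.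

(** Evaluation of a functional with coefficients [c] at [y]. It is left linear in [c] and right
    linear in [y], and so identifies each of the two free modules with the dual of the other. *)
Definition pairing m (c : free_mod L m) (y : free_mod R m) : L :=
  \sum_i (c i : L) * (y i : L).

Lemma pairing_linearr m (c : free_mod L m) : linear (pairing c : free_mod R m ->
  R^o).
Proof.
move=> a x y; rewrite /pairing scaler_sumr -big_split /=; apply: eq_bigr => i _.
by rewrite !ffunE /= mulrDr; congr (_ + _); exact: (@mulrA L (c i) (x i) a).
Qed.

Lemma pairing_linearl m (y : free_mod R m) : linear (fun c : free_mod L m =>
  pairing c y : L^o).
Proof.
move=> a c d; rewrite /pairing scaler_sumr -big_split /=; apply: eq_bigr => i _.
by rewrite !ffunE /= mulrDl; congr (_ + _); rewrite /GRing.scale /= mulrA.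
Qed.

Definition pairr m (c : free_mod L m) : {linear free_mod R m -> R^o} :=
  mk_linear (pairing_linearr c).

Definition pairl m (y : free_mod R m) : {linear free_mod L m -> L^o} :=
  mk_linear (pairing_linearl y).

Lemma pairr_gen m (c : free_mod L m) i : pairr c (free_gen R i) = c i.
Proof.
rewrite /= /pairing (bigD1 i) //= big1 => [|j ji]; rewrite !ffunE ?eqxx.
  by rewrite [X in X + _]mulr1 addr0.
by rewrite (negPf ji) [LHS]mulr0.
Qed.

Lemma pairl_gen m (y : free_mod R m) i : pairl y (free_gen L i) = y i.
Proof.
rewrite /= /pairing (bigD1 i) //= big1 => [|j ji]; rewrite !ffunE ?eqxx.
  by rewrite [X in X + _]mul1r addr0.
by rewrite (negPf ji) [LHS]mul0r.
Qed.

Lemma functional_pairr m (f : {linear free_mod R m -> R^o}) :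
  f =1 pairr [ffun i => f (free_gen R i)].
Proof. by apply: free_mod_ext => i; rewrite pairr_gen ffunE. Qed.

Lemma functional_pairl m (f : {linear free_mod L m -> L^o}) :
  f =1 pairl [ffun i => f (free_gen L i)].
Proof. by apply: free_mod_ext => i; rewrite pairl_gen ffunE. Qed.

(* [i : D -> L^m] presents the left module X^* = Hom(X, R) through the
   functionals on R^m that factor through [p : R^m -> X]. *)
Definition is_dual m X (p : {linear free_mod R m -> X})
    (D : lmodType L) (i : {linear D -> free_mod L m}) : Prop :=
  injective i /\
  forall c, (exists d, c = i d) <-> forall y, p y = 0 -> pairing c y = 0.

Lemma dual_exists m X (p : {linear free_mod R m -> X}) :
  exists (D : lmodType L) (i : {linear D -> free_mod L m}), is_dual p i.
Proof.
have sS : is_submod (fun c : free_mod L m => forall y, p y = 0 -> pairing c y = 0).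
  split=> [y _|a c c' Sc Sc' y py]; first exact: (linear0 (pairl y)).
  by rewrite [LHS](linearP (pairl y)) /= Sc // Sc' // scaler0 addr0.
have [D [i [inj_i iP]]] := submodule_exists sS.
by exists D, i; split=> // c; rewrite -iP.
Qed.

Section OneStep.
Variables (m m1 : nat) (X : lmodType R).
Variables (p : {linear free_mod R m -> X}) (p1 : {linear free_mod R m1 -> Ker p}).
Hypotheses (sp : surjective p) (sp1 : surjective p1) (extX : Ext1 X R^o).
Variables (D D1 : lmodType L).
Variables (i : {linear D -> free_mod L m}) (i1 : {linear D1 -> free_mod L m1}).
Hypotheses (dualD : is_dual p i) (dualD1 : is_dual p1 i1).

(** [g] restricts functionals from R^m to [Ker p]. Its kernel is the dual of [X], and it is
    surjective because Ext^1(X,R) = 0 lets functionals on [Ker p] extend. *)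
Lemma dual_short_exact : exists g : {linear free_mod L m -> D1},
  short_exact i g /\
  forall c y, pairing (i1 (g c)) y = pairing c (ker_incl p (p1 y)).
Proof.
have lin_t : linear (fun c : free_mod L m =>
    [ffun j => pairing c (ker_incl p (p1 (free_gen R j)))] : free_mod L m1).
  by move=> a c d; apply/ffunP => j; rewrite !ffunE pairing_linearl.
pose t := mk_linear lin_t.
have tE c y : pairing (t c) y = pairing c (ker_incl p (p1 y)).
  apply: (free_mod_ext (f := pairr (t c)) (g := pairr c \o ker_incl p \o p1)) => j.
  by rewrite pairr_gen ffunE.
have [inj_i iP] := dualD; have [inj_i1 i1P] := dualD1.
have [c|g gP] := factor_inj (phi := t) inj_i1.
  by apply/i1P => y p1y; rewrite tE p1y linear0; apply: (linear0 (pairr c)).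
have gE c y : pairing (i1 (g c)) y = pairing c (ker_incl p (p1 y)) by rewrite -gP
  tE.
exists g; split=> //; split=> // [c|d].
  split=> [gc0|/iP c0].
    apply/iP => y /ker_exact [x ->]; have [z ->] := sp1 x.
    by rewrite -gE gc0 linear0; apply: (linear0 (pairl z)).
  apply: inj_i1; rewrite linear0 -gP; apply/ffunP => j; rewrite !ffunE.
  by apply: c0; apply/ker_exact; exists (p1 (free_gen R j)).
have [y p1y|theta thetaP] := factor_surj (phi := pairr (i1 d)) sp1.
  by have /i1P := ex_intro (fun d' => i1 d = i1 d') d erefl; apply.
have [psi psiP] := extX (ker_short_exact sp) theta.
exists [ffun j => psi (free_gen R j)]; apply: inj_i1; rewrite -gP.
apply/ffunP => j; rewrite ffunE -[LHS]pairr_gen thetaP psiP.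
exact: functional_pairr.
Qed.

End OneStep.

Hypothesis noethR : noetherian R.

(** By [dual_short_exact] the dual of [X] is a syzygy of the dual of [Ker p], which satisfies the
    same vanishing; so the process can be repeated [k] times. *)
Lemma dual_psyz k m X (p : {linear free_mod R m -> X}) (D : lmodType L)
    (i : {linear D -> free_mod L m}) :
    surjective p -> (forall j, Ext_zero j X R^o) -> is_dual p i ->
  exists E, psyz k E D.
Proof.
elim: k m X p D i => [|k IHk] m X p D i sp extX dualD.
  by exists D; apply: isomorphic_refl.
have fK : fin_gen (Ker p) by apply: noethR (@ker_incl_inj _ _ _ p)
  (free_mod_fin_gen R m).
have [m1 [p1 sp1]] := free_cover fK; have [D1 [i1 dualD1]] := dual_exists p1.
have extK j : Ext_zero j (Ker p) R^o.
  move=> M KM; apply: (extX j.+1); apply: (@psyz_cat _ 1 j _ (Ker p)) KM.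
  apply: psyz1; exists (free_mod R m), (ker_incl p), p; split.
    exact: free_mod_projective.
  exact: ker_short_exact.
have [E ED1] := IHk _ _ p1 D1 i1 sp1 extK dualD1.
have extX1 : Ext1 X R^o by apply: (extX 0%N); apply: isomorphic_refl.
have [g [ig _]] := dual_short_exact sp sp1 extX1 dualD dualD1.
exists E; exists D1 => //; exists (free_mod L m), i, g; split=> //.
exact: free_mod_projective.
Qed.

(* With X = R^m/K1 and K1 = R^m1/K2, evaluation at [y] on (R^m)^* kills X^* when
   the class of [y] is killed by X^*, hence is a functional on K1^*; it extends
   to (R^m1)^* because Ext^1(K2^*, L) = 0, so it is evaluation at an element of
   K1, which must be [y]. *)
Lemma torsionless_of_injdim d X : injdim_le d (L^o : lmodType L) ->
    fin_gen X -> (forall j, Ext_zero j X R^o) ->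
  forall x : X, (forall f : {linear X -> R^o}, f x = 0) -> x = 0.
Proof.
move=> injdimL fX extX x fx0.
have [m [p sp]] := free_cover fX.
have kernel_data m' (Y : lmodType R) (q : {linear free_mod R m' -> Y}) :
    surjective q -> (forall j, Ext_zero j Y R^o) ->
    (forall j, Ext_zero j (Ker q) R^o) /\ fin_gen (Ker q).
  move=> sq extY; split;
    last exact: noethR (@ker_incl_inj _ _ _ q) (free_mod_fin_gen R m').
  move=> j M KM; apply: (extY j.+1); apply: (@psyz_cat _ 1 j _ (Ker q)) KM.
  apply: psyz1; exists (free_mod R m'), (ker_incl q), q; split.
    exact: free_mod_projective.
  exact: ker_short_exact.
have [extK fK] := kernel_data _ _ p sp extX.
have [m1 [p1 sp1]] := free_cover fK.
have [extK1 fK1] := kernel_data _ _ p1 sp1 extK.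
have [m2 [p2 sp2]] := free_cover fK1.
have [D [i dualD]] := dual_exists p; have [D1 [i1 dualD1]] := dual_exists p1.
have [D2 [i2 dualD2]] := dual_exists p2.
have ext1 (Y : lmodType R) : (forall j, Ext_zero j Y R^o) -> Ext1 Y R^o.
  by move=> /(_ 0%N); apply; apply: isomorphic_refl.
have [g [ig gE]] := dual_short_exact sp sp1 (ext1 _ extX) dualD dualD1.
have [g1 [ig1 _]] := dual_short_exact sp1 sp2 (ext1 _ extK) dualD1 dualD2.
have [y xy] := sp x; have [_ ex_ig sg] := ig.
have [c /ex_ig [e ->]|theta thetaP] := factor_surj (phi := pairl y) sg.
  have [_ /(_ (i e)) [/(_ (ex_intro _ e erefl)) ie0 _]] := dualD.
  have [z pz|f fP] := factor_surj (phi := pairr (i e)) sp; first exact: ie0.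
  by have := fP y; rewrite -xy fx0.
have extD2 : Ext1 D2 L^o.
  by have [E ED2] := dual_psyz d sp2 extK1 dualD2; apply: injdim_Ext1 injdimL ED2.
have [h hP] := extD2 _ _ _ _ ig1 theta.
(* A functional on the free left module is evaluation at the vector of its values on the basis. *)
pose z := [ffun j => h (free_gen L j)] : free_mod R m1.
have yz : y = ker_incl p (p1 z).
  apply/ffunP => j; rewrite -pairl_gen thetaP hP [LHS](functional_pairl h) /= gE.
  exact: (pairl_gen (ker_incl p (p1 z)) j).
by rewrite xy yz; apply/ker_exact; exists (p1 z).
Qed.

End Duality.

(** * Specialization to right modules over a Gorenstein artin algebra *)

Theorem proposition3p9 (k : comPzRingType) (L : algType k)
    (n : nat) (C : lmodType L^c -> Prop) :
  artin_algebra L -> gorenstein L -> (0 < n)%N ->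
  nZ_cluster_tilting C n ->
  nZ_G_cluster_tilting n C /\
  (forall X : lmodType L^c, nZ_Gprj n C X <-> Gprj X /\ C X) /\
  (forall X : lmodType L^c, nZ_Ginj n C X <-> Ginj X /\ C X).
Proof.
move=> artinL [[d injdimR] [d' injdimL]] n_gt0 ctC.
pose z : k -> L^c := @central_scalar k L.
have zC t r : z t * r = r * z t by apply: esym; apply: central_scalarC.
have finR : finite_length z ((L^c)^o : lmodType L^c).
  have [N lenL] := artin_algebra_length artinL; exists N; rewrite /zlen_le.
  (* Scaling in the right regular module is right multiplication in [L], which agrees with left
     multiplication on central elements. *)
  have -> // : @zact L^c k z (L^c)^o = fun t x => central_scalar L t * x.
  by apply/funext => t; apply/funext => x; apply: esym; apply: central_scalarC.
have noeth := central_noetherian finR.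
have enough_inj := central_enough_fg_injectives zC finR.
split; last first.
  split=> X; first exact: (ct_nZ_Gprj noeth enough_inj n_gt0 ctC).
  exact: (ct_nZ_Ginj noeth enough_inj n_gt0 ctC).
apply: (gorenstein_nZ_G_cluster_tilting noeth enough_inj injdimR) => //.
- exact: regular_fg_projective.
- by move=> X [fX extX]; apply: torsionless_of_injdim injdimL fX extX.
- exact: (left_projective_approx zC finR).
- exact: (right_injective_approx zC finR).
Qed.
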